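(* Let $F \in \mathcal{G}$. The reversing symmetry group $\mathcal{R}_{\mathcal{G}}(F)$ is (up to isomorphism of groups in (1) and (3)–(5)): (1) $C_\infty$ if and only if $F$ is not reversible; (2) $\mathcal{G}$ if and only if $F = \mathrm{Id}$; (3) $D_2 \simeq C_2 \times C_2$ if and only if $F^2 = \mathrm{Id} \neq F$; (4) $D_3$ if and only if $F^3 = \mathrm{Id} \neq F$; or (5) $D_\infty$, if $F$ is truly reversible but not of finite order.
   Context: Let $I(x,y,z) = x^2+y^2+z^2-2xyz-1$ (the Fricke–Vogt invariant). Let $$\mathcal{G} = \{F \in \mathbb{Z}[x,y,z]^3 \mid I(F(x,y,z)) = I(x,y,z) \text{ and } F(1,1,1) = (1,1,1)\},$$ the set of Nielsen trace maps, viewed as polynomial mappings of 3-space. It is known that $\mathcal{G}$ is a group under composition and that $\mathcal{G} \simeq PGl(2,\mathbb{Z}) \simeq Gl(2,\mathbb{Z})/\{\pm \mathbf{1}\}$. $\mathrm{Id}$ denotes the identity mapping and $F^n$ the $n$-fold composition. Let $F \in \mathcal{G}$. A symmetry of $F$ within $\mathcal{G}$ is an $S \in \mathcal{G}$ with $F \circ S = S \circ F$. A reversing symmetry of $F$ within $\mathcal{G}$ is a $G \in \mathcal{G}$ with $G \circ F \circ G^{-1} = F^{-1}$. The reversing symmetry group $\mathcal{R}_{\mathcal{G}}(F)$ is the group formed by all symmetries and reversing symmetries of $F$ within $\mathcal{G}$, i.e. $\mathcal{R}_{\mathcal{G}}(F) = \{G \in \mathcal{G} \mid G \circ F \circ G^{-1}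 = F \text{ or } G \circ F \circ G^{-1} = F^{-1}\}$. $F$ is called reversible if it has a reversing symmetry within $\mathcal{G}$ (so every $F$ with $F^2 = \mathrm{Id}$ is trivially reversible), and truly reversible if it is reversible and $F^2 \neq \mathrm{Id}$. $C_n$ is the cyclic group of order $n$ and $C_\infty \simeq \mathbb{Z}$ the infinite cyclic group. $D_n \simeq C_n \rtimes C_2$ is the dihedral group of order $2n$ (with $C_2$ acting by inversion), and $D_\infty \simeq C_\infty \rtimes C_2$ is the infinite dihedral group. *)

(* Defs.v *)
From HB Require Import structures.
From mathcomp Require Import all_boot all_order all_algebra.
From mathcomp Require Export mpoly.

Set Implicit Arguments.
Unset Strict Implicit.
Unset Printing Implicit Defensive.

Import GRing.Theory.
Local Open Scope ring_scope.

(* [Zxyz]^3 is a monoid under composition of polynomial mappings, written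
   multiplicatively: [(F * G)%g] is "first G, then F", [1%g] is the identity
   (x, y, z), and [(F ^+ n)%g] is the n-fold composition. *)

Notation Zxyz := {mpoly int[3]}.

Definition poly_map := (3.-tuple Zxyz)%type.

HB.instance Definition _ := Choice.on poly_map.

Definition poly_comp (F G : poly_map) : poly_map :=
  [tuple tnth F i \mPo G | i < 3].

Definition poly_id : poly_map := [tuple 'X_i | i < 3].

Lemma comp_mpolyA (p : Zxyz) (F G : poly_map) :
  p \mPo poly_comp F G = (p \mPo F) \mPo G.
Proof.
rewrite [p \mPo F]comp_mpolyEX [LHS]comp_mpolyEX raddf_sum /=.
apply: eq_bigr => m _; rewrite comp_mpolyZ; congr (_ *: _).
rewrite !comp_mpolyX rmorph_prod /=; apply: eq_bigr => i _.
by rewrite rmorphXn /= tnth_mktuple.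
Qed.

Lemma poly_compA : associative poly_comp.
Proof.
by move=> F G H; apply: eq_from_tnth => i; rewrite !tnth_mktuple comp_mpolyA.
Qed.

Lemma poly_comp1g : left_id poly_id poly_comp.
Proof.
move=> F; apply: eq_from_tnth => i.
by rewrite !tnth_mktuple comp_mpolyXU -tnth_nth.
Qed.

Lemma poly_compg1 : right_id poly_id poly_comp.
Proof.
by move=> F; apply: eq_from_tnth => i; rewrite !tnth_mktuple comp_mpoly_id.
Qed.

HB.instance Definition _ :=
  isMonoid.Build poly_map poly_compA poly_comp1g poly_compg1.

Definition fricke_vogt : Zxyz :=
  let x := 'X_0 in let y := 'X_1 in let z := 'X_2 in
  x ^+ 2 + y ^+ 2 + z ^+ 2 - 2 * x * y * z - 1.

Definition nielsen : pred poly_map := fun F =>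
  (fricke_vogt \mPo F == fricke_vogt) &&
  [forall i, (tnth F i).@[fun=> 1] == 1].

Lemma nielsen_umagma_closed : umagma_closed nielsen.
Proof.
split=> [|F G /andP[/eqP IF /'forall_eqP F1] /andP[/eqP IG /'forall_eqP G1]].
  apply/andP; split; first by rewrite comp_mpoly_id.
  by apply/'forall_eqP => i; rewrite tnth_mktuple mevalXU.
apply/andP; split; first by rewrite comp_mpolyA IF IG.
apply/'forall_eqP => i; rewrite tnth_mktuple comp_mpoly_meval -[RHS](F1 i).
by apply: meval_eq => j; rewrite G1.
Qed.

Definition trace_map := {F : poly_map | F \in nielsen}.

HB.instance Definition _ := SubChoice.on trace_map.
HB.instance Definition _ :=
  SubChoice_isSubMonoid.Build poly_map nielsen trace_map nielsen_umagma_closed.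

(* The monoid [trace_map] is in fact a group, but invertibility of its elements
   is a theorem; inverses are therefore introduced relationally (they are unique
   in any monoid). *)
Definition is_inverse (F F' : trace_map) : Prop :=
  (F * F' = 1 /\ F' * F = 1)%g.

Definition is_symmetry (F S : trace_map) : Prop := (F * S = S * F)%g.

Definition is_reversing_symmetry (F G : trace_map) : Prop :=
  exists F' G' : trace_map,
    [/\ is_inverse F F', is_inverse G G' & (G * F * G' = F')%g].

Definition rev_sym_group (F : trace_map) : trace_map -> Prop :=
  fun G => is_symmetry F G \/ is_reversing_symmetry F G.

Definition reversible (F : trace_map) : Prop :=
  exists G, is_reversing_symmetry F G.

Definition truly_reversible (F : trace_map) : Prop :=
  reversible F /\ (F ^+ 2 <> 1)%g.

Definition finite_order (F : trace_map) : Prop :=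
  exists2 n, (0 < n)%N & (F ^+ n = 1)%g.

(* A bijection onto [A] compatible with the products makes [A] a group with the
   composition of [M], so this says that [A] is a group isomorphic to [gT]. *)
Definition isomorphic_to (M : monoidType) (A : M -> Prop) (gT : groupType) :
  Prop :=
  exists f : UMagmaMorphism.type gT M,
    injective f /\ (forall x, A x <-> exists g, f g = x).

(* Semidirect product of an additive group [A] with C_2 = [bool], the generator
   [true] acting by inversion. *)
Definition dihedral (A : Type) := (A * bool)%type.

HB.instance Definition _ (A : choiceType) := Choice.on (dihedral A).

Section Dihedral.
Variable A : zmodType.
Implicit Types u v w : dihedral A.

Definition dih_mul u v : dihedral A :=
  ((if u.2 then u.1 - v.1 else u.1 + v.1), u.2 (+) v.2).

Definition dih_one : dihedral A := (0, false).

Definition dih_inv u : dihedral A := ((if u.2 then u.1 else - u.1), u.2).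

Lemma dih_mulA : associative dih_mul.
Proof.
move=> [a []] [b []] [c []]; rewrite /dih_mul /= ?addrA //;
  by rewrite ?opprD ?opprK ?addrA.
Qed.

Lemma dih_mul1g : left_id dih_one dih_mul.
Proof. by move=> [a s]; rewrite /dih_mul /= add0r. Qed.

Lemma dih_mulg1 : right_id dih_one dih_mul.
Proof. by move=> [a []]; rewrite /dih_mul /= ?subr0 ?addr0. Qed.

Lemma dih_mulVg : left_inverse dih_one dih_inv dih_mul.
Proof. by move=> [a []]; rewrite /dih_mul /= ?subrr ?addNr. Qed.

Lemma dih_mulgV : right_inverse dih_one dih_inv dih_mul.
Proof. by move=> [a []]; rewrite /dih_mul /= ?subrr. Qed.

HB.instance Definition _ := isGroup.Build (dihedral A)
  dih_mulA dih_mul1g dih_mulg1 dih_mulVg dih_mulgV.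

End Dihedral.

Definition C_2 : groupType := Algebra.to_multiplicative 'Z_2.
Definition C_oo : groupType := Algebra.to_multiplicative int.
Definition D_2 : groupType := dihedral 'Z_2.
Definition D_3 : groupType := dihedral 'Z_3.
Definition D_oo : groupType := dihedral int.

(* Main.v *)
(** The trace maps are parametrized by PGL(2,Z). On the surface where the
    invariant vanishes, parametrized by (cosh u, cosh v, cosh (u + v)), a trace
    map acts as an integer matrix on (u, v), determined up to sign. Existence
    of the matrix comes from a Markov-type descent on leading monomials: as long
    as a solution of I(f, g, h) = I is not a permutation of (x, y, z), the
    leading term of its largest component f is that of 2gh, and replacing f by
    2gh - f gives a smaller solution. Faithfulness comes from following the
    hexagonal form a^2 - ab + b^2 along the same descent: it grows strictly with
    each step, so that only permutations can act as the identity.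

    In PGL(2,Z) everything is governed by the discriminant tr^2 - 4 det of the
    matrix A of F. If F <> Id has finite order it is -4, 4 (order 2) or -3 (order 3);
    the centralizer is then computed directly and a reversing involution is
    produced by reduction of binary quadratic forms. Otherwise the centralizer
    of F is infinite cyclic, by a second descent: for commuting x and y, one of
    x y and x y^-1 is smaller than x if x is at least as large as y. A reversing
    symmetry G must then invert a generator of the centralizer, which forces
    G^2 = 1. *)
Require Import Defs.
From HB Require Import structures.
From Stdlib Require Import Classical_Prop.
From mathcomp Require Import all_boot all_order all_algebra.
From mathcomp Require Import zify ring.

Set Implicit Arguments.
Unset Strict Implicit.
Unset Printing Implicit Defensive.

Import Order.TTheory GRing.Theory Num.Theory.
Local Open Scope ring_scope.

(** * Generators and descent *)

Definition component (F : trace_map) (i : 'I_3) : Zxyz := tnth (val F) i.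

Lemma ord3_ind (P : 'I_3 -> Prop) : P 0 -> P 1 -> P 2 -> forall i, P i.
Proof.
move=> P0 P1 P2 [[|[|[|//]]] lti].
- by rewrite (_ : Ordinal lti = 0) //; apply/val_inj.
- by rewrite (_ : Ordinal lti = 1) //; apply/val_inj.
- by rewrite (_ : Ordinal lti = 2) //; apply/val_inj.
Qed.

Lemma trace_map_eq (F G : trace_map) : component F =1 component G -> F = G.
Proof. by move=> FG; apply/val_inj/eq_from_tnth. Qed.

Lemma componentM (F G : trace_map) i :
  component (F * G)%g i = component F i \mPo val G.
Proof. by rewrite /component (valM F G) /= tnth_mktuple. Qed.

Lemma component1 i : component 1%g i = 'X_i.
Proof. by rewrite /component (val1 trace_map) tnth_mktuple. Qed.

Lemma fricke_vogt_comp (F : poly_map) :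
  fricke_vogt \mPo F = tnth F 0 ^+ 2 + tnth F 1 ^+ 2 + tnth F 2 ^+ 2
    - 2 * tnth F 0 * tnth F 1 * tnth F 2 - 1.
Proof.
rewrite /fricke_vogt !(rmorphB, rmorphD, rmorphM, rmorphXn, rmorph1) /=.
by rewrite !comp_mpolyXU -!tnth_nth.
Qed.

Lemma nielsenI (f g h : Zxyz) :
  f ^+ 2 + g ^+ 2 + h ^+ 2 - 2 * f * g * h - 1 = fricke_vogt ->
  f.@[fun=> 1] = 1 -> g.@[fun=> 1] = 1 -> h.@[fun=> 1] = 1 ->
  ([tuple f; g; h] : poly_map) \in nielsen.
Proof.
move=> eqI f1 g1 h1; apply/andP; split.
  by rewrite fricke_vogt_comp; apply/eqP.
by apply/'forall_eqP => i; elim/ord3_ind: i.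
Qed.

Lemma trace_map_fricke (F : trace_map) :
  component F 0 ^+ 2 + component F 1 ^+ 2 + component F 2 ^+ 2
    - 2 * component F 0 * component F 1 * component F 2 - 1 = fricke_vogt.
Proof. by case: F => F Fn; rewrite -fricke_vogt_comp; case/andP: (Fn) => /eqP. Qed.

Lemma trace_map_one (F : trace_map) i : (component F i).@[fun=> 1] = 1.
Proof. by case: F => F Fn; case/andP: (Fn) => _ /'forall_eqP ->. Qed.

Fact swap_nielsen : ([tuple 'X_1; 'X_0; 'X_2] : poly_map) \in nielsen.
Proof. by apply: nielsenI; rewrite ?mevalXU // /fricke_vogt; ring. Qed.
Definition swap : trace_map := exist (fun F => F \in nielsen) _ swap_nielsen.

Fact rotation_nielsen : ([tuple 'X_1; 'X_2; 'X_0] : poly_map) \in nielsen.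
Proof. by apply: nielsenI; rewrite ?mevalXU // /fricke_vogt; ring. Qed.
Definition rotation : trace_map := exist (fun F => F \in nielsen) _ rotation_nielsen.

Fact flip_nielsen :
  ([tuple 2 * 'X_1 * 'X_2 - 'X_0; 'X_1; 'X_2] : poly_map) \in nielsen.
Proof.
apply: nielsenI; rewrite ?mevalXU //; first by rewrite /fricke_vogt; ring.
by rewrite rmorphB !rmorphM rmorph_nat /= !mevalXU.
Qed.
Definition flip : trace_map := exist (fun F => F \in nielsen) _ flip_nielsen.

Lemma component_swapM F :
  [/\ component (swap * F)%g 0 = component F 1,
      component (swap * F)%g 1 = component F 0
    & component (swap * F)%g 2 = component F 2].
Proof. by split; rewrite componentM comp_mpolyXU -tnth_nth. Qed.

Lemma component_rotationM F :
  [/\ component (rotation * F)%g 0 = component F 1,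
      component (rotation * F)%g 1 = component F 2
    & component (rotation * F)%g 2 = component F 0].
Proof. by split; rewrite componentM comp_mpolyXU -tnth_nth. Qed.

Lemma component_flipM F :
  [/\ component (flip * F)%g 0
        = 2 * component F 1 * component F 2 - component F 0,
      component (flip * F)%g 1 = component F 1
    & component (flip * F)%g 2 = component F 2].
Proof.
split; rewrite componentM ?comp_mpolyXU -?tnth_nth //.
rewrite [component flip 0]/component /=.
by rewrite rmorphB !rmorphM rmorph_nat /= !comp_mpolyXU -!tnth_nth.
Qed.

Lemma swap_sq : (swap * swap = 1)%g.
Proof.
by apply: trace_map_eq; have [e0 e1 e2] := component_swapM swap; elim/ord3_ind;
   rewrite ?e0 ?e1 ?e2 component1.
Qed.

Lemma rotation_cube : (rotation * (rotation * rotation) = 1)%g.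
Proof.
have [e0 e1 e2] := component_rotationM rotation.
have [d0 d1 d2] := component_rotationM (rotation * rotation)%g.
by apply: trace_map_eq; elim/ord3_ind; rewrite ?d0 ?d1 ?d2 ?e0 ?e1 ?e2 component1.
Qed.

Lemma flip_sq : (flip * flip = 1)%g.
Proof.
have [e0 e1 e2] := component_flipM flip.
apply: trace_map_eq; elim/ord3_ind; rewrite ?e0 ?e1 ?e2 component1 //.
by rewrite /component /= opprB addrC subrK.
Qed.

(** * Leading monomials and the descent step *)

Definition mnm_xyz : 'X_{1..3} := (U_(0%R) + U_(1%R) + U_(2%R))%MM.

Lemma double_neq_mnm_xyz (m : 'X_{1..3}) : (m + m)%MM != mnm_xyz.
Proof.
apply/eqP => /mnmP /(_ 0); rewrite !mnmDE !mnm1E /= => /(congr1 odd).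
by rewrite addnn odd_double.
Qed.

Lemma mleadM_neq0 (p q : Zxyz) :
  p != 0 -> q != 0 -> mlead (p * q) = (mlead p + mlead q)%MM.
Proof.
by move=> p0 q0; apply: mleadM_proper; rewrite mulf_neq0 ?mleadc_eq0.
Qed.

Definition quadratic_part : Zxyz := 'X_0 ^+ 2 + 'X_1 ^+ 2 + 'X_2 ^+ 2.

Lemma mlead_xyz : mlead (2 * 'X_0 * 'X_1 * 'X_2 : Zxyz) = mnm_xyz.
Proof.
have -> : 2 * 'X_0 * 'X_1 * 'X_2 = 2%:R *: 'X_[mnm_xyz] :> Zxyz.
  by rewrite scaler_nat !mpolyXD; ring.
by rewrite mleadZ_proper mleadXm // mcoeffX eqxx.
Qed.

(** The constant is left free because two cases occur: [c = 1] gives the invariant itself, and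
    [c = 0] the combination f^2 + g^2 + h^2 - 2fgh used in the descent. *)
Lemma mlead_quadratic_part (c : int) : (mlead (quadratic_part - c%:MP) < mnm_xyz)%O.
Proof.
have sq i : (mlead ('X_i ^+ 2 : Zxyz) < mnm_xyz)%O.
  apply: lt_mdeg_ltmc; rewrite (leq_ltn_trans (lemc_mdeg (mleadX_le _ _))) //.
  by rewrite mleadXm mdegMn !mdegD !mdeg1.
have lt0 : (mlead (- c%:MP : Zxyz) < mnm_xyz)%O.
  by rewrite mleadN mleadC lt_mdeg_ltmc // mdeg0 !mdegD !mdeg1.
by do 3![apply: le_lt_trans (mleadD_le _ _) _; rewrite ltUx ?sq ?lt0 ?andbT //].
Qed.

Lemma fricke_vogtE (c : int) :
  fricke_vogt + 1 - c%:MP = (quadratic_part - c%:MP) - 2 * 'X_0 * 'X_1 * 'X_2.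
Proof. by rewrite /fricke_vogt /quadratic_part; ring. Qed.

Lemma mlead_fricke_vogt (c : int) : mlead (fricke_vogt + 1 - c%:MP) = mnm_xyz.
Proof.
by rewrite fricke_vogtE mleadDr mleadN mlead_xyz // mlead_quadratic_part.
Qed.

Lemma mlead_eq0_polyC (p : Zxyz) : mlead p = 0%MM -> p = (p@_0)%:MP.
Proof.
move=> p0; have [->|pn0] := eqVneq p 0; first by rewrite mcoeff0 mpolyC0.
by apply: msize1_polyC; rewrite -mlead_deg // p0 mdeg0.
Qed.

Lemma component_neq0 (F : trace_map) i : component F i != 0.
Proof. by apply/eqP => F0; have:= trace_map_one F i; rewrite F0 rmorph0. Qed.

Lemma component_mlead_eq0 (F : trace_map) i :
  mlead (component F i) = 0%MM -> component F i = 1.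
Proof.
move/mlead_eq0_polyC => Fi; have := trace_map_one F i; rewrite Fi mevalC => ->.
by rewrite mpolyC1.
Qed.

(** A constant component equals 1, and then the invariant becomes the square of the difference of
    the other two components; but its leading monomial xyz is not that of a square. *)
Lemma mlead_component_neq0 (F : trace_map) i : mlead (component F i) != 0%MM.
Proof.
have key (p q : Zxyz) : (p - q) ^+ 2 <> fricke_vogt.
  move=> pq.
  have pq0 : p - q != 0.
    apply/eqP => pq0; have := mlead_fricke_vogt 1.
    rewrite mpolyC1 addrK -pq pq0 expr0n mlead0 => /(congr1 (@mdeg _)).
    by rewrite mdeg0 !mdegD !mdeg1.
  have := mlead_fricke_vogt 1; rewrite mpolyC1 addrK -pq expr2 mleadM_neq0 //.
  exact/eqP/double_neq_mnm_xyz.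
apply/eqP => /component_mlead_eq0 Fi1; have := trace_map_fricke F.
elim/ord3_ind: i Fi1 => ->.
- by move=> FI; apply: (key (component F 1) (component F 2)); rewrite -FI; ring.
- by move=> FI; apply: (key (component F 0) (component F 2)); rewrite -FI; ring.
- by move=> FI; apply: (key (component F 0) (component F 1)); rewrite -FI; ring.
Qed.

(* Leading terms of squares cannot cancel over the integers, and the leading
   monomial xyz of the invariant is not a square: so the leading terms of
   [f^2 + g^2 + h^2] and [2fgh] cancel each other unless the latter is the
   leading term of the invariant. *)
Lemma trace_map_descent (F : trace_map) (f := component F 0)
    (g := component F 1) (h := component F 2) :
  (mlead g <= mlead f)%O -> (mlead h <= mlead f)%O ->
  (mlead f + mlead g + mlead h)%MM = mnm_xyz \/
  mlead f = (mlead g + mlead h)%MM /\ (mlead (2 * g * h - f)%R < mlead f)%O.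
Proof.
move=> le_gf le_hf; pose S := f * f + g * g + h * h; pose T := 2 * f * g * h.
have [f0 g0 h0] : [/\ f != 0, g != 0 & h != 0].
  by split; apply: component_neq0.
have [a0 b0 c0] : [/\ mlead f != 0%MM, mlead g != 0%MM & mlead h != 0%MM].
  by split; apply: mlead_component_neq0.
have ST : S - T = fricke_vogt + 1 - 0%:MP.
  by rewrite -(trace_map_fricke F) -/f -/g -/h mpolyC0 subr0 /S /T; ring.
have leadST : mlead (S - T) = mnm_xyz by rewrite ST mlead_fricke_vogt.
set a := mlead f in le_gf le_hf a0 *; set b := mlead g in le_gf b0 *.
set c := mlead h in le_hf c0 *.
have Sa : S@_(a + a) = f@_a ^+ 2 + g@_a ^+ 2 + h@_a ^+ 2.
  by rewrite !mcoeffD !mleadcMW.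
have Sa_neq0 : S@_(a + a) != 0.
  by rewrite Sa gt_eqF // -addrA ltr_wpDr ?addr_ge0 ?sqr_ge0 // exprn_even_gt0 // mleadc_eq0.
have le_Sa : (mlead S <= (a + a)%MM)%O.
  have le_sq p : (mlead p <= a -> mlead (p * p)%R <= (a + a)%MM)%O.
    by move=> le_p; rewrite (le_trans (mleadM_le _ _)) ?lem_add.
  apply: le_trans (mleadD_le _ _) _; rewrite leUx le_sq // andbT.
  by apply: le_trans (mleadD_le _ _) _; rewrite leUx !le_sq.
have lead_S : mlead S = (a + a)%MM.
  by apply/eqP; rewrite eq_le le_Sa msupp_le_mlead // mcoeff_msupp.
have lead2f : mlead (2 * f) = a.
  by rewrite mulr_natl -scaler_nat mleadZ_proper // mulf_neq0 // mleadc_eq0.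
have two0 : 2 != 0 :> Zxyz by rewrite -mpolyC_nat mpolyC_eq0.
have lead_T : mlead T = (a + b + c)%MM.
  by rewrite /T !(@mleadM_neq0 (2 * f * g), @mleadM_neq0 (2 * f)) ?mulf_neq0 // lead2f.
(* The larger of the two leading monomials must be xyz, which a + a is not; in case of equality a =
   b + c. *)
have [lt_ST|lt_TS|eq_ST] := ltgtP (a + a)%MM (a + b + c)%MM.
- by left; rewrite -leadST addrC mleadDl mleadN // lead_T lead_S.
- have := double_neq_mnm_xyz a; rewrite -leadST mleadDl ?lead_S ?eqxx //.
  by rewrite mleadN lead_T.
have Ea : a = (b + c)%MM by apply/eqP; rewrite -(eqm_add2l a) addmA; apply/eqP.
right; split=> //.
have lt_ba : (b < a)%O by rewrite Ea -[ltLHS]addm0 ltmc_add2r lt0x.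
have lt_ca : (c < a)%O by rewrite Ea -[ltLHS]add0m ltmc_add2l lt0x.
(* The monomial a + a is not xyz, so it is absent from S - T. Comparing coefficients gives f_a^2 = 2
   f_a g_b h_c, so f and 2gh have the same leading term. *)
have ST_a : (S - T)@_(a + a) = 0.
  have [lt_a|lt_a|/eqP] := ltgtP mnm_xyz (a + a)%MM.
  - by rewrite mcoeff_gt_mlead // leadST.
  - have: (mlead (S - T) <= (a + a)%MM)%O.
      by rewrite (le_trans (mleadB_le _ _)) // lead_T -eq_ST leUx lead_S lexx.
    by rewrite leadST leNgt lt_a.
  - by rewrite eq_sym (negPf (double_neq_mnm_xyz a)).
have Ta : T@_(a + a) = 2 * f@_a * (g@_b * h@_c).
  have -> : T = (f * (g * h)) *+ 2 by rewrite /T; ring.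
  by rewrite mcoeffMn {2}Ea !mleadcMW // ?Ea -?mleadM_neq0 //; ring.
have Efa : f@_a = 2 * (g@_b * h@_c).
  have := ST_a; rewrite mcoeffB Sa Ta !(mcoeff_gt_mlead lt_ba, mcoeff_gt_mlead lt_ca).
  have : f@_a != 0 by rewrite mleadc_eq0.
  move=> fa0 /eqP; rewrite expr0n /= !addr0 subr_eq0 => /eqP E.
  by apply: (mulfI fa0); rewrite -expr2 E; ring.
set p := 2 * g * h - f.
have pa : p@_a = 0.
  have -> : p = (g * h) *+ 2 - f by rewrite /p; ring.
  by rewrite mcoeffB mcoeffMn {1}Ea mleadcM Efa; ring.
have le_pa : (mlead p <= a)%O.
  rewrite (le_trans (mleadB_le _ _)) // leUx lexx andbT.
  by rewrite -mulrA (le_trans (mleadM_le _ _)) // mleadM_neq0 // -Ea -mpolyC_nat mleadC add0m.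
(* If p still had leading monomial a, its zero coefficient there would make p = 0, whose leading
   monomial is 0 by convention, whereas a is not 0. *)
rewrite lt_neqAle le_pa andbT; apply/eqP => Ep; move: pa.
rewrite -Ep => /eqP; rewrite mleadc_eq0 => /eqP p0.
by move: a0; rewrite -Ep p0 mlead0 eqxx.
Qed.

Lemma mpoly_affineE (p : Zxyz) : (mdeg (mlead p) <= 1)%N ->
  p = p@_U_(0%R) *: 'X_0 + p@_U_(1%R) *: 'X_1 + p@_U_(2%R) *: 'X_2 + (p@_0)%:MP.
Proof.
move=> le_p1; apply/mpolyP => m.
rewrite !mcoeffD !mcoeffZ !mcoeffX mcoeffC.
have [lt1m|] := ltnP 1 (mdeg m).
  have m_neq (m' : 'X_{1..3}) : (mdeg m' <= 1)%N -> (m' == m) = false.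
    by move=> le; apply/eqP => mE; move: le; rewrite mE leqNgt lt1m.
  rewrite mcoeff_gt_mlead ?lt_mdeg_ltmc ?(leq_ltn_trans le_p1) //.
  by rewrite !m_neq ?mdeg1 // eq_sym m_neq ?mdeg0 // !mulr0 !addr0.
rewrite leq_eqVlt ltnS leqn0 mdeg_eq0 => /orP[/mdeg1P[i /eqP ->]|/eqP ->].
  rewrite mnm1_eq0 mulr0 addr0 !eq_mnm1.
  by elim/ord3_ind: i; rewrite /= ?mulr0 ?mulr1 ?addr0 ?add0r.
by rewrite !mnm1_eq0 eqxx !mulr0 mulr1 !add0r.
Qed.

(** Finite differences of the defect [D] at points with coordinates 0, 1, -1 extract the
    coefficients of y^2 z, x z^2, y z^2, xy, xz and yz in turn. The later ones reduce to a single
    product once the earlier parameters are known to vanish; the factor -8 is -2 from the term -2fgh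
    times 4 from the differences. *)
Lemma affine_fricke_vogt_id (a0 a1 a2 a b1 b2 b c2 c : int) :
  a0 * b1 * c2 != 0 ->
  (forall x y z, let f := a0 * x + a1 * y + a2 * z + a in
     let g := b1 * y + b2 * z + b in let h := c2 * z + c in
     f ^+ 2 + g ^+ 2 + h ^+ 2 - 2 * f * g * h
       = x ^+ 2 + y ^+ 2 + z ^+ 2 - 2 * x * y * z) ->
  [/\ a1 = 0, a2 = 0 & a = 0] /\ [/\ b2 = 0, b = 0 & c = 0].
Proof.
rewrite !mulf_eq0 !negb_or => /andP[/andP[a00 b10] c20] FI.
pose D x y z := let f := a0 * x + a1 * y + a2 * z + a in
  let g := b1 * y + b2 * z + b in let h := c2 * z + c in
  f ^+ 2 + g ^+ 2 + h ^+ 2 - 2 * f * g * h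
    - (x ^+ 2 + y ^+ 2 + z ^+ 2 - 2 * x * y * z).
have D0 x y z : D x y z = 0 by rewrite /D FI subrr.
have eq0 (t : int) : -8 * t = 0 -> t = 0.
  by move/eqP; rewrite mulf_eq0 => /eqP.
have a10 : a1 = 0.
  have : a1 * b1 * c2 = 0.
    apply/eq0; transitivity (D 0 1 1 + D 0 (-1) 1 - 2 * D 0 0 1
      - (D 0 1 (-1) + D 0 (-1) (-1) - 2 * D 0 0 (-1))); last by rewrite !D0.
    by rewrite /D; ring.
  by move/eqP; rewrite !mulf_eq0 (negPf b10) (negPf c20) !orbF => /eqP.
have b20 : b2 = 0.
  have : a0 * b2 * c2 = 0.
    apply/eq0; transitivity (D 1 0 1 + D 1 0 (-1) - 2 * D 1 0 0
      - (D (-1) 0 1 + D (-1) 0 (-1) - 2 * D (-1) 0 0)); last by rewrite !D0.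
    by rewrite /D; ring.
  by move/eqP; rewrite !mulf_eq0 (negPf a00) (negPf c20) !orbF => /eqP.
have a20 : a2 = 0.
  have : a2 * b1 * c2 = 0.
    apply/eq0; transitivity (D 0 1 1 + D 0 1 (-1) - 2 * D 0 1 0
      - (D 0 (-1) 1 + D 0 (-1) (-1) - 2 * D 0 (-1) 0)); last by rewrite !D0.
    by rewrite /D a10; ring.
  by move/eqP; rewrite !mulf_eq0 (negPf b10) (negPf c20) !orbF => /eqP.
have c0 : c = 0.
  have : a0 * b1 * c = 0.
    apply/eq0; transitivity (D 1 1 0 - D 1 (-1) 0 - D (-1) 1 0 + D (-1) (-1) 0);
      last by rewrite !D0.
    by rewrite /D a10; ring.
  by move/eqP; rewrite !mulf_eq0 (negPf a00) (negPf b10) => /eqP.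
have b0 : b = 0.
  have : a0 * b * c2 = 0.
    apply/eq0; transitivity (D 1 0 1 - D 1 0 (-1) - D (-1) 0 1 + D (-1) 0 (-1));
      last by rewrite !D0.
    by rewrite /D a20 b20; ring.
  by move/eqP; rewrite !mulf_eq0 (negPf a00) (negPf c20) orbF => /eqP.
have a'0 : a = 0.
  have : a * b1 * c2 = 0.
    apply/eq0; transitivity (D 0 1 1 - D 0 1 (-1) - D 0 (-1) 1 + D 0 (-1) (-1));
      last by rewrite !D0.
    by rewrite /D a10 a20 b20; ring.
  by move/eqP; rewrite !mulf_eq0 (negPf b10) (negPf c20) !orbF => /eqP.
by [].
Qed.

Lemma ltmc1 (i j : 'I_3) : (j < i)%N -> (U_(i)%MM < U_(j)%MM)%O.
Proof.
move=> lt_ji; apply/ltmcP; first by rewrite !mdeg1.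
exists j => [k lt_kj|]; rewrite !mnm1E.
  by rewrite -!val_eqE /= !gtn_eqF // (ltn_trans lt_kj).
by rewrite eqxx -val_eqE /= gtn_eqF.
Qed.

(** As x > y > z in the monomial order, the components are affine and triangular. Preserving the
    invariant makes them diagonal without constant terms, and fixing (1,1,1) makes the coefficients
    1. *)
Lemma trace_map_affine_eq1 (F : trace_map) :
  (forall i, mlead (component F i) = U_(i)%MM) -> F = 1%g.
Proof.
move=> leadF; have affF i := @mpoly_affineE (component F i).
have Fcoef i : (component F i)@_(U_(i)) != 0.
  by rewrite -leadF mleadc_eq0 component_neq0.
have Fcoef0 (i j : 'I_3) : (j < i)%N -> (component F i)@_(U_(j)) = 0.
  by move=> lt_ji; rewrite mcoeff_gt_mlead // leadF ltmc1.
have [a0 [a1 [a2 [a [a00 F0]]]]] : exists a0 a1 a2 a : int, a0 != 0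
    /\ component F 0 = a0 *: 'X_0 + a1 *: 'X_1 + a2 *: 'X_2 + a%:MP.
  by do 4 eexists; split; [exact: (Fcoef 0) | apply: affF; rewrite leadF mdeg1].
have [b1 [b2 [b [b10 F1]]]] : exists b1 b2 b : int, b1 != 0
    /\ component F 1 = b1 *: 'X_1 + b2 *: 'X_2 + b%:MP.
  have := affF 1; rewrite leadF mdeg1 (Fcoef0 1 0) // scale0r add0r => /(_ isT) F1.
  by do 3 eexists; split; [exact: (Fcoef 1) | exact: F1].
have [c2 [c [c20 F2]]] : exists c2 c : int, c2 != 0
    /\ component F 2 = c2 *: 'X_2 + c%:MP.
  have := affF 2; rewrite leadF mdeg1 (Fcoef0 2 0) // (Fcoef0 2 1) // !scale0r !add0r.
  by move=> /(_ isT) F2; do 2 eexists; split; [exact: (Fcoef 2) | exact: F2].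
have [] := @affine_fricke_vogt_id a0 a1 a2 a b1 b2 b c2 c.
- by rewrite !mulf_neq0.
- move=> x y z f g h; pose v : 'I_3 -> int := tnth [tuple x; y; z].
  have Ef : (component F 0).@[v] = f by rewrite F0 !mevalD !mevalZ !mevalXU mevalC.
  have Eg : (component F 1).@[v] = g by rewrite F1 !mevalD !mevalZ !mevalXU mevalC.
  have Eh : (component F 2).@[v] = h by rewrite F2 !mevalD !mevalZ !mevalXU mevalC.
  have := congr1 (meval v) (trace_map_fricke F).
  rewrite /fricke_vogt !(mevalB, mevalD, mevalM, rmorphXn, meval1).
  by rewrite Ef Eg Eh !mevalXU => /addIr.
move=> [a10 a20 a'0] [b20 b0 c0].
have := trace_map_one F 0; have := trace_map_one F 1; have := trace_map_one F 2.
rewrite F0 F1 F2 a10 a20 a'0 b20 b0 c0 !scale0r !addr0 !mevalZ !mevalXU !mulr1.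
move=> Ec Eb Ea; apply: trace_map_eq; elim/ord3_ind; rewrite component1.
- by rewrite F0 a10 a20 a'0 Ea !scale0r !addr0 scale1r.
- by rewrite F1 b20 b0 Eb !scale0r !addr0 scale1r.
- by rewrite F2 c0 Ec !addr0 scale1r.
Qed.

Lemma mnm_xyz_perm (l : 'I_3 -> 'X_{1..3}) :
  (forall i, l i != 0%MM) -> (l 0%R + l 1%R + l 2%R)%MM = mnm_xyz ->
  exists i j k, [/\ l 0%R = U_(i)%MM, l 1%R = U_(j)%MM, l 2%R = U_(k)%MM
    & (i, j, k) \in [:: (0, 1, 2); (0, 2, 1); (1, 0, 2); (1, 2, 0); (2, 0, 1); (2, 1, 0)]].
Proof.
move=> l0 suml.
have degl i : (0 < mdeg (l i))%N by rewrite lt0n mdeg_eq0.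
have := congr1 (@mdeg _) suml; rewrite !mdegD !mdeg1 => degsum.
have deg1 i : mdeg (l i) == 1%N.
  have := (degl 0, degl 1, degl 2) => -[[? ?] ?].
  by elim/ord3_ind: i; apply/eqP; lia.
have /mdeg1P[i /eqP li] := deg1 0; have /mdeg1P[j /eqP lj] := deg1 1.
have /mdeg1P[k /eqP lk] := deg1 2.
exists i, j, k; split=> //; move: suml; rewrite li lj lk => /mnmP E.
move: (E 0) (E 1) (E 2); rewrite !mnmDE !mnm1E.
by clear; elim/ord3_ind: i; elim/ord3_ind: j; elim/ord3_ind: k.
Qed.

(** Well-founded induction on the product of the three leading monomials. The hypothesis in the flip
    case records that flips are only used in the growing direction, which the norm argument depends
    on. *)
Lemma trace_map_ind (P : trace_map -> Prop) :
  P 1%g -> (forall F, P F -> P (swap * F)%g) ->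
  (forall F, P F -> P (rotation * F)%g) ->
  (forall F, P F ->
     (mlead (component F 0)
       < (mlead (component F 1%R) + mlead (component F 2%R))%MM)%O ->
     P (flip * F)%g) ->
  forall F, P F.
Proof.
move=> P1 Pswap Protation Pflip F.
have swapP G : P (swap * G)%g -> P G.
  by move/Pswap; rewrite mulgA swap_sq mul1g.
have rotationP G : P (rotation * G)%g -> P G.
  by move/Protation/Protation; rewrite !mulgA -(mulgA rotation) rotation_cube mul1g.
pose leads G := (mlead (component G 0%R) + mlead (component G 1%R)
                  + mlead (component G 2%R))%MM.
have [m] : exists m, leads F = m by exists (leads F).
elim/(@ltmwf 3): m F => m IH F le_m.
(* Rotations bring the largest leading monomial to the front and keep the product. *)
wlog [le10 le20] : F le_m / (mlead (component F 1) <= mlead (component F 0))%O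
    /\ (mlead (component F 2) <= mlead (component F 0))%O.
  move=> Pmax; have [e0 e1 e2] := component_rotationM F.
  have [d0 d1 d2] := component_rotationM (rotation * F)%g.
  have [le01|lt10] := leP (mlead (component F 0)) (mlead (component F 1)).
    have [le12|lt21] := leP (mlead (component F 1)) (mlead (component F 2)).
      apply/rotationP/rotationP/Pmax; rewrite /leads ?d0 ?d1 ?d2 ?e0 ?e1 ?e2.
        by rewrite -le_m /leads -addmA addmC.
      by split; rewrite // (le_trans le01).
    apply/rotationP/Pmax; rewrite /leads ?e0 ?e1 ?e2.
      by rewrite -le_m /leads addmC addmA.
    by split=> //; apply: ltW.
  have [le02|lt20] := leP (mlead (component F 0)) (mlead (component F 2)).
    apply/rotationP/rotationP/Pmax; rewrite /leads ?d0 ?d1 ?d2 ?e0 ?e1 ?e2.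
      by rewrite -le_m /leads -addmA addmC.
    by split; rewrite // (le_trans (ltW lt10)).
  by apply: Pmax => //; split; apply: ltW.
have [|[lead0 lt_flip]] := trace_map_descent le10 le20.
  (* End of the descent: the leading monomials are x, y, z in some order, and a word in [swap] and
     [rotation] sorts them. *)
  move/(mnm_xyz_perm (mlead_component_neq0 F)) => [i [j [k [Ei Ej Ek ijk]]]].
  have Psorted G : mlead (component G 0) = U_(0%R)%MM ->
      mlead (component G 1) = U_(1%R)%MM -> mlead (component G 2) = U_(2%R)%MM ->
      P G.
    move=> G0 G1 G2; rewrite (_ : G = 1%g) //.
    by apply: trace_map_affine_eq1; elim/ord3_ind.
  have [e0 e1 e2] := component_rotationM F.
  have [d0 d1 d2] := component_rotationM (rotation * F)%g.
  have [f0 f1 f2] := component_swapM F.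
  have [g0 g1 g2] := component_swapM (rotation * F)%g.
  have [h0 h1 h2] := component_swapM (rotation * (rotation * F))%g.
  move: ijk; rewrite !inE => /orP[|/orP[|/orP[|/orP[|/orP[]]]]] /eqP[Ei' Ej' Ek'];
    move: Ei Ej Ek; rewrite {}Ei' {}Ej' {}Ek' => E0 E1 E2.
  - exact: Psorted.
  - by apply/rotationP/rotationP/swapP/Psorted; rewrite ?h0 ?h1 ?h2 ?d0 ?d1 ?d2 ?e0 ?e1 ?e2.
  - by apply/swapP/Psorted; rewrite ?f0 ?f1 ?f2.
  - by apply/rotationP/rotationP/Psorted; rewrite ?d0 ?d1 ?d2 ?e0 ?e1 ?e2.
  - by apply/rotationP/Psorted; rewrite ?e0 ?e1 ?e2.
  - by apply/rotationP/swapP/Psorted; rewrite ?g0 ?g1 ?g2 ?e0 ?e1 ?e2.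
have [e0 e1 e2] := component_flipM F.
(* [F] is the flip of the smaller map [flip * F]. *)
rewrite -[F]mul1g -flip_sq -mulgA; apply: Pflip; last by rewrite e0 e1 e2 -lead0.
apply: (IH (leads (flip * F)%g)) => //.
by rewrite -le_m /leads e0 e1 e2 -!addmA ltmc_le_add.
Qed.

(** * The matrix of a trace map *)

(* The Chebyshev values T_n(2): an integer-valued substitute for the
   hyperbolic cosine in the parametrization (cosh u, cosh v, cosh (u + v)) of
   the surface on which the invariant vanishes. *)
Fixpoint chebyshev_nat (n : nat) : int :=
  match n with
  | 0 => 1
  | 1 => 2
  | (n'.+1 as m).+1 => 4 * chebyshev_nat m - chebyshev_nat n'
  end.

Lemma chebyshev_natSS n :
  chebyshev_nat n.+2 = 4 * chebyshev_nat n.+1 - chebyshev_nat n.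
Proof. by []. Qed.

(** This is T_(m+n) + T_(m-n) = 2 T_m T_n with m = k + n, free of subtraction on naturals. The
    recurrence has order two, so the induction carries two consecutive values of n, for all k. *)
Lemma chebyshev_natD k n :
  chebyshev_nat (k + n + n) + chebyshev_nat k
    = 2 * chebyshev_nat (k + n) * chebyshev_nat n.
Proof.
suff: (forall k, chebyshev_nat (k + n + n) + chebyshev_nat k
         = 2 * chebyshev_nat (k + n) * chebyshev_nat n) /\
      (forall k, chebyshev_nat (k + n.+1 + n.+1) + chebyshev_nat k
         = 2 * chebyshev_nat (k + n.+1) * chebyshev_nat n.+1) by case.
elim: n {k} => [|n [IHn IHn1]].
  by split=> k; rewrite ?addn0 ?addn1 /=; ring.
split=> // k; have := IHn k.+2; have := IHn1 k.+1.
rewrite !(addSn, addnS) !chebyshev_natSS => E1 E2.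
move: E1 E2; clear; lia.
Qed.

Lemma chebyshev_nat_incr n :
  0 < chebyshev_nat n /\ chebyshev_nat n < chebyshev_nat n.+1.
Proof.
elim: n => [|n [n_gt0 n_lt]] //; rewrite chebyshev_natSS; lia.
Qed.

Definition chebyshev (n : int) : int := chebyshev_nat `|n|.

Lemma chebyshevN n : chebyshev (- n) = chebyshev n.
Proof. by rewrite /chebyshev abszN. Qed.

Lemma chebyshevD m n :
  chebyshev (m + n) + chebyshev (m - n) = 2 * chebyshev m * chebyshev n.
Proof.
wlog n_ge0 : n / 0 <= n.
  move=> W; have [/W//|/ltW n_le0] := leP 0 n.
  by have := W (- n); rewrite oppr_ge0 opprK chebyshevN addrC => ->.
wlog m_ge0 : m / 0 <= m.
  move=> W; have [/W//|/ltW m_le0] := leP 0 m.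
  have := W (- m); rewrite oppr_ge0 -opprD (addrC (- m) n) -opprB !chebyshevN.
  by rewrite addrC => ->.
wlog le_nm : m n m_ge0 n_ge0 / n <= m.
  move=> W; have [/W->//|/ltW le_mn] := leP n m.
  by rewrite mulrAC -W // addrC [n + m]addrC -(chebyshevN (n - m)) opprB addrC.
case: m n m_ge0 n_ge0 le_nm => // m [] // n _ _ le_nm.
have -> : m = (m - n + n)%N :> nat by lia.
rewrite /chebyshev /= -chebyshev_natD; congr (chebyshev_nat _ + chebyshev_nat _); lia.
Qed.

Lemma chebyshev_inj m n : chebyshev m = chebyshev n -> m = n \/ m = - n.
Proof.
have incr : {homo chebyshev_nat : a b / (a < b)%N >-> a < b}.
  by apply: homo_ltn => [? ? ?|i]; [exact: lt_trans | case: (chebyshev_nat_incr i)].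
rewrite /chebyshev => E; suff: `|m|%N = `|n|%N by lia.
by case: (ltngtP `|m|%N `|n|%N) => // /incr; rewrite E ltxx.
Qed.

Definition cosh_point (i j : int) : 'I_3 -> int :=
  tnth [tuple chebyshev i; chebyshev j; chebyshev (i + j)].

Lemma cosh_pointN i j : cosh_point (- i) (- j) =1 cosh_point i j.
Proof. by move=> k; rewrite /cosh_point -opprD !chebyshevN. Qed.

Definition represents (F : trace_map) (A : 'M[int]_2) : Prop :=
  forall i j k, (component F k).@[cosh_point i j]
    = cosh_point (A 0 0 * i + A 0 1 * j) (A 1 0 * i + A 1 1 * j) k.

Lemma mulmx2E (R : pzRingType) (A B : 'M[R]_2) i j :
  (A * B) i j = A i 0 * B 0 j + A i 1 * B 1 j.
Proof.
rewrite mxE !big_ord_recl big_ord0 addr0.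
by congr (_ * B _ _ + A _ _ * B _ _); apply/val_inj.
Qed.

Lemma represents1 : represents 1%g 1.
Proof.
by move=> i j k; rewrite component1 mevalXU !mxE /= !mul1r !mul0r addr0 add0r.
Qed.

Lemma representsN F A : represents F A -> represents F (- A).
Proof.
move=> FA i j k; rewrite FA -cosh_pointN !mxE !mulNr -!opprD //.
Qed.

Lemma representsM F G A B :
  represents F A -> represents G B -> represents (F * G)%g (A * B).
Proof.
move=> FA GB i j k; rewrite componentM comp_mpoly_meval.
rewrite (@meval_eq _ _ _ (cosh_point (B 0 0 * i + B 0 1 * j) (B 1 0 * i + B 1 1 * j))).
  by rewrite FA !mulmx2E; congr (cosh_point _ _ k); ring.
by move=> l; rewrite GB.
Qed.

Definition mx2 (a b c d : int) : 'M[int]_2 :=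
  \matrix_(i, j) if i == 0 then if j == 0 then a else b
                 else if j == 0 then c else d.

Lemma ord2_ind (P : 'I_2 -> Prop) : P 0 -> P 1 -> forall i, P i.
Proof.
move=> P0 P1 [[|[|//]] lti].
- by rewrite (_ : Ordinal lti = 0) //; apply/val_inj.
- by rewrite (_ : Ordinal lti = 1) //; apply/val_inj.
Qed.

Lemma mx2_eta (A : 'M[int]_2) : A = mx2 (A 0 0) (A 0 1) (A 1 0) (A 1 1).
Proof. by apply/matrixP; elim/ord2_ind; elim/ord2_ind; rewrite mxE. Qed.

Lemma mx2E a b c d : (mx2 a b c d 0 0 = a) * (mx2 a b c d 0 1 = b)
  * (mx2 a b c d 1 0 = c) * (mx2 a b c d 1 1 = d).
Proof. by rewrite !mxE. Qed.

Lemma mx2M a b c d a' b' c' d' : mx2 a b c d * mx2 a' b' c' d' =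
  mx2 (a * a' + b * c') (a * b' + b * d') (c * a' + d * c') (c * b' + d * d').
Proof. by apply/matrixP; elim/ord2_ind; elim/ord2_ind; rewrite mulmx2E !mxE. Qed.

Lemma mx2D a b c d a' b' c' d' : mx2 a b c d + mx2 a' b' c' d' =
  mx2 (a + a') (b + b') (c + c') (d + d').
Proof. by apply/matrixP; elim/ord2_ind; elim/ord2_ind; rewrite !mxE. Qed.

Lemma mx2N a b c d : - mx2 a b c d = mx2 (- a) (- b) (- c) (- d).
Proof. by apply/matrixP; elim/ord2_ind; elim/ord2_ind; rewrite !mxE. Qed.

Lemma mx2Z k a b c d : k *: mx2 a b c d = mx2 (k * a) (k * b) (k * c) (k * d).
Proof. by apply/matrixP; elim/ord2_ind; elim/ord2_ind; rewrite !mxE. Qed.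

Lemma mx2_scalar a : a%:M = mx2 a 0 0 a.
Proof. by apply/matrixP; elim/ord2_ind; elim/ord2_ind; rewrite !mxE ?mulr1n ?mulr0n. Qed.

Lemma mx2_1 : 1 = mx2 1 0 0 1 :> 'M[int]_2.
Proof. exact: mx2_scalar. Qed.

Lemma mx2_inj a b c d a' b' c' d' : mx2 a b c d = mx2 a' b' c' d' ->
  [/\ a = a', b = b', c = c' & d = d'].
Proof.
by move/matrixP=> E; move: (E 0 0) (E 0 1) (E 1 0) (E 1 1); rewrite !mxE.
Qed.

Lemma tr_mx2 a b c d : \tr (mx2 a b c d) = a + d.
Proof. by rewrite /mxtrace !big_ord_recl big_ord0 !mxE addr0. Qed.

Lemma det_mx2 a b c d : \det (mx2 a b c d) = a * d - b * c.
Proof.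
rewrite (expand_det_row _ 0) !big_ord_recl big_ord0 /cofactor !det_mx11 !mxE /=.
by rewrite expr0 mul1r mulN1r addr0 mulrN.
Qed.

Lemma mx2_ind (P : 'M[int]_2 -> Prop) :
  (forall a b c d, P (mx2 a b c d)) -> forall A, P A.
Proof. by move=> Pmx A; rewrite (mx2_eta A). Qed.

Lemma represents_mx2 F a b c d : represents F (mx2 a b c d) <->
  forall i j k, (component F k).@[cosh_point i j]
    = cosh_point (a * i + b * j) (c * i + d * j) k.
Proof. by rewrite /represents !mx2E. Qed.

Lemma represents_swap : represents swap (mx2 0 1 1 0).
Proof.
apply/represents_mx2 => i j k; rewrite !mul0r !mul1r add0r addr0.
by elim/ord3_ind: k; rewrite /component /= mevalXU // /cosh_point /= addrC.
Qed.

Lemma represents_rotation : represents rotation (mx2 0 1 (-1) (-1)).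
Proof.
apply/represents_mx2 => i j k; rewrite mul0r mul1r add0r !mulN1r -opprD.
elim/ord3_ind: k; rewrite /component /= mevalXU // /cosh_point /= ?chebyshevN //.
by rewrite opprD addrCA subrr addr0 chebyshevN.
Qed.

(** The sign of the first row is dictated by the third coordinate, which has to stay i + j up to
    sign: -(i + 2j) + j = -(i + j). *)
Lemma represents_flip : represents flip (mx2 (-1) (-2) 0 1).
Proof.
apply/represents_mx2 => i j k; rewrite mul0r mul1r add0r.
elim/ord3_ind: k; rewrite /component /=.
- rewrite mevalB !mevalM !mevalXU (_ : meval _ 2 = 2); last by rewrite -mpolyC_nat mevalC.
  rewrite /cosh_point /= -(chebyshevN (-1 * i + _)).
  have := chebyshevD (i + j) j; rewrite addrK => E.
  rewrite (_ : - (-1 * i + -2 * j) = i + j + j); last by ring.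
  by rewrite -(addrK (chebyshev i) (chebyshev (i + j + j))) E mulrAC.
- by rewrite mevalXU.
- rewrite mevalXU /cosh_point /= -(chebyshevN (-1 * i + _ + _)); congr chebyshev; ring.
Qed.

(** This form equals 1 on (1, 0), (0, 1) and (1, 1), which are the rows of the identity and their
    sum. *)
Definition hexagonal_form (a b : int) : int := a ^+ 2 - a * b + b ^+ 2.

Definition row_norm (A : 'M[int]_2) : 'I_3 -> int :=
  tnth [tuple hexagonal_form (A 0 0) (A 0 1); hexagonal_form (A 1 0) (A 1 1);
    hexagonal_form (A 0 0 + A 1 0) (A 0 1 + A 1 1)].

Lemma row_norm_mx2 a b c d (A := mx2 a b c d) :
  (row_norm A 0 = hexagonal_form a b) * (row_norm A 1 = hexagonal_form c d)
  * (row_norm A 2 = hexagonal_form (a + c) (b + d)).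
Proof. by rewrite /row_norm /A !mx2E. Qed.

Definition peak (F : trace_map) (A : 'M[int]_2) (i j k : 'I_3) :=
  [/\ mlead (component F i) = (mlead (component F j) + mlead (component F k))%MM,
      row_norm A j < row_norm A i & row_norm A k < row_norm A i].

(* Either F is a permutation of the coordinates, or the component with the
   largest leading monomial is also the one whose row has the largest norm. *)
Definition normal_form (F : trace_map) (A : 'M[int]_2) :=
  (forall k, (exists l, component F k = 'X_l) /\ row_norm A k = 1)
  \/ [\/ peak F A 0 1 2, peak F A 1 2 0 | peak F A 2 0 1].

Lemma normal_form_swap F A :
  normal_form F A -> normal_form (swap * F)%g (mx2 0 1 1 0 * A).
Proof.
have [e0 e1 e2] := component_swapM F.
have [n0 n1 n2] : [/\ row_norm (mx2 0 1 1 0 * A) 0 = row_norm A 1,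
   row_norm (mx2 0 1 1 0 * A) 1 = row_norm A 0 &
   row_norm (mx2 0 1 1 0 * A) 2 = row_norm A 2].
  elim/mx2_ind: A => a b c d; rewrite mx2M !row_norm_mx2.
  by split; rewrite /hexagonal_form; ring.
case=> [base|pk]; [left|right; move: pk].
  by elim/ord3_ind; rewrite ?e0 ?e1 ?e2 ?n0 ?n1 ?n2.
case=> -[E lt1 lt2]; [constructor 2|constructor 1|constructor 3];
  by split; rewrite ?e0 ?e1 ?e2 ?n0 ?n1 ?n2 // addmC.
Qed.

Lemma normal_form_rotation F A :
  normal_form F A -> normal_form (rotation * F)%g (mx2 0 1 (-1) (-1) * A).
Proof.
have [e0 e1 e2] := component_rotationM F.
have [n0 n1 n2] : [/\ row_norm (mx2 0 1 (-1) (-1) * A) 0 = row_norm A 1,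
   row_norm (mx2 0 1 (-1) (-1) * A) 1 = row_norm A 2 &
   row_norm (mx2 0 1 (-1) (-1) * A) 2 = row_norm A 0].
  elim/mx2_ind: A => a b c d; rewrite mx2M !row_norm_mx2.
  by split; rewrite /hexagonal_form; ring.
case=> [base|pk]; [left|right; move: pk].
  by elim/ord3_ind; rewrite ?e0 ?e1 ?e2 ?n0 ?n1 ?n2.
case=> -[E lt1 lt2]; [constructor 3|constructor 1|constructor 2];
  by split; rewrite ?e0 ?e1 ?e2 ?n0 ?n1 ?n2.
Qed.

(** By the parallelogram law the first norm becomes 2 n_1 + 2 n_2 - n_0. It exceeds n_1 and n_2 when
    all norms are 1 and when the old peak is at 1 or 2; a peak at 0 contradicts the growth
    hypothesis. *)
Lemma normal_form_flip F A :
  (mlead (component F 0)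
     < (mlead (component F 1%R) + mlead (component F 2%R))%MM)%O ->
  normal_form F A -> normal_form (flip * F)%g (mx2 (-1) (-2) 0 1 * A).
Proof.
move=> lt0; have [e0 e1 e2] := component_flipM F.
have lead0 : mlead (component (flip * F)%g 0)
    = (mlead (component F 1%R) + mlead (component F 2%R))%MM.
  have lead2 : mlead (2 * component F 1 * component F 2)
      = (mlead (component F 1%R) + mlead (component F 2%R))%MM.
    rewrite -mulrA mulr_natl -scaler_nat mleadZ_proper ?mleadM_neq0 ?component_neq0 //.
    by rewrite mleadcM !mulf_neq0 // mleadc_eq0 component_neq0.
  by rewrite e0 mleadDl ?mleadN lead2.
have [n0 n1 n2 n_ge0] : [/\ row_norm (mx2 (-1) (-2) 0 1 * A) 0
     = 2 * row_norm A 1 + 2 * row_norm A 2 - row_norm A 0,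
   row_norm (mx2 (-1) (-2) 0 1 * A) 1 = row_norm A 1,
   row_norm (mx2 (-1) (-2) 0 1 * A) 2 = row_norm A 2
   & 0 <= row_norm A 1 /\ 0 <= row_norm A 2].
  elim/mx2_ind: A => a b c d; rewrite mx2M !row_norm_mx2.
  have ge0 x y : 0 <= hexagonal_form x y by rewrite /hexagonal_form; nia.
  by split; rewrite ?ge0 // /hexagonal_form; ring.
move=> nfF; right; constructor 1; split; rewrite ?lead0 ?e1 ?e2 ?n0 ?n1 ?n2 //.
- case: nfF n_ge0 => [base|[[E _ _]|[_]|[_]]]; first 1 last.
  + by rewrite E ltxx in lt0.
  + by move=> ? ? []; lia.
  + by move=> ? ? []; lia.
  + by have [[_ ->] [[_ ->] [_ ->]]] := (base 0, (base 1, base 2)).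
- case: nfF n_ge0 => [base|[[E _ _]|[_]|[_]]]; first 1 last.
  + by rewrite E ltxx in lt0.
  + by move=> ? ? []; lia.
  + by move=> ? ? []; lia.
  + by have [[_ ->] [[_ ->] [_ ->]]] := (base 0, (base 1, base 2)).
Qed.

Definition eqpm (A B : 'M[int]_2) := A = B \/ A = - B.

Lemma eqpm_refl A : eqpm A A. Proof. by left. Qed.

Lemma eqpm_sym A B : eqpm A B -> eqpm B A.
Proof. by case=> ->; [left | right; rewrite opprK]. Qed.

Lemma eqpm_trans B A C : eqpm A B -> eqpm B C -> eqpm A C.
Proof. by case=> -> [->|->]; rewrite ?opprK; [left|right|right|left]. Qed.

Lemma eqpmM A B A' B' : eqpm A A' -> eqpm B B' -> eqpm (A * B) (A' * B').
Proof.
by case=> -> [] ->; rewrite ?mulrN ?mulNr ?opprK; [left|right|right|left].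
Qed.

Lemma eqpmX A B n : eqpm A B -> eqpm (A ^+ n) (B ^+ n).
Proof.
by move=> AB; elim: n => [|n IH]; rewrite ?exprS; [left | apply: eqpmM].
Qed.

Lemma represents_eqpm F A B : represents F B -> eqpm A B -> represents F A.
Proof. by move=> FB [] -> //; apply: representsN. Qed.

Lemma trace_map_normal_form F :
  exists2 A, represents F A & \det A ^+ 2 = 1 /\ normal_form F A.
Proof.
have det_gen a b c d A : (a * d - b * c) ^+ 2 = 1 ->
    \det A ^+ 2 = 1 -> \det (mx2 a b c d * A) ^+ 2 = 1.
  by move=> g1 A1; rewrite det_mulmx exprMn det_mx2 g1 A1.
elim/trace_map_ind: F => [|F [A FA [detA nfA]]|F [A FA [detA nfA]]|F [A FA [detA nfA]] lt0].
- exists 1; first exact: represents1.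
  split; first by rewrite det1.
  left=> k; split; first by exists k; rewrite component1.
  by rewrite mx2_1; elim/ord3_ind: k; rewrite row_norm_mx2.
- exists (mx2 0 1 1 0 * A); first exact: representsM represents_swap FA.
  by split; [apply: det_gen | apply: normal_form_swap].
- exists (mx2 0 1 (-1) (-1) * A); first exact: representsM represents_rotation FA.
  by split; [apply: det_gen | apply: normal_form_rotation].
- exists (mx2 (-1) (-2) 0 1 * A); first exact: representsM represents_flip FA.
  by split; [apply: det_gen | apply: normal_form_flip].
Qed.

(* A matrix is determined up to sign by its action on three points, which makes
   the property decidable. *)
Definition represents_test (F : trace_map) (A : 'M[int]_2) : bool :=
  (\det A ^+ 2 == 1) &&
  [forall k, [&& (component F k).@[cosh_point 1 0] == cosh_point (A 0 0) (A 1 0) k,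
    (component F k).@[cosh_point 0 1] == cosh_point (A 0 1) (A 1 1) k
  & (component F k).@[cosh_point 1 1]
      == cosh_point (A 0 0 + A 0 1) (A 1 0 + A 1 1) k]].

Lemma represents_testW F A :
  \det A ^+ 2 = 1 -> represents F A -> represents_test F A.
Proof.
move=> detA FA; apply/andP; split; first exact/eqP.
by apply/forallP => k; rewrite !FA !mulr1 !mulr0 !addr0 !add0r !eqxx.
Qed.

(** Chebyshev values of two entries and of their sum determine a row up to sign. Applied to both
    rows and to the sum of the rows, this shows that the two signs agree. *)
Lemma represents_test_uniq F A B :
  represents_test F A -> represents_test F B -> eqpm A B.
Proof.
move=> /andP[_ /forallP FA] /andP[_ /forallP FB].
elim/mx2_ind: A FA => a b c d FA; elim/mx2_ind: B FB => a' b' c' d' FB.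
have row_eq (x y x' y' : int) : chebyshev x = chebyshev x' ->
    chebyshev y = chebyshev y' -> chebyshev (x + y) = chebyshev (x' + y') ->
    x = x' /\ y = y' \/ x = - x' /\ y = - y'.
  by move=> /chebyshev_inj[->|->] /chebyshev_inj[->|->] /chebyshev_inj[]; lia.
have entries k : [/\ cosh_point a c k = cosh_point a' c' k,
    cosh_point b d k = cosh_point b' d' k
  & cosh_point (a + b) (c + d) k = cosh_point (a' + b') (c' + d') k].
  have /and3P[] := FA k; rewrite !mx2E => /eqP <- /eqP <- /eqP <-.
  by have /and3P[] := FB k; rewrite !mx2E => /eqP <- /eqP <- /eqP <-.
have [ra rb rab] := entries 0; have [rc rd rcd] := entries 1.
have [rac rbd rabcd] := entries 2.
suff [[-> -> -> ->]|[-> -> -> ->]] : [/\ a = a', b = b', c = c' & d = d']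
    \/ [/\ a = - a', b = - b', c = - c' & d = - d'].
- by left.
- by right; rewrite mx2N.
have := row_eq _ _ _ _ ra rb rab; have := row_eq _ _ _ _ rc rd rcd.
have : a + c = a' + c' /\ b + d = b' + d' \/ a + c = - (a' + c') /\ b + d = - (b' + d').
  by apply: row_eq => //; rewrite addrACA [in RHS]addrACA.
by move=> [[? ?]|[? ?]] [[? ?]|[? ?]] [[? ?]|[? ?]];
  first [left; split; lia | right; split; lia].
Qed.

Fact mx_subproof F : exists A, represents_test F A.
Proof.
by have [A FA [detA _]] := trace_map_normal_form F; exists A; apply: represents_testW.
Qed.

(** A representative of an element of PGL(2,Z): the sign is an arbitrary choice, so identities for
    [mx] hold up to [eqpm] only. *)
Definition mx (F : trace_map) : 'M[int]_2 := xchoose (mx_subproof F).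

Lemma mx_uniq F A : \det A ^+ 2 = 1 -> represents F A -> eqpm (mx F) A.
Proof.
move=> detA FA; apply: (@represents_test_uniq F); first exact: (xchooseP (mx_subproof F)).
exact: represents_testW.
Qed.

Lemma represents_mx F : represents F (mx F).
Proof.
have [A FA [detA _]] := trace_map_normal_form F.
exact: represents_eqpm FA (mx_uniq detA FA).
Qed.

Lemma det_mx_sq F : \det (mx F) ^+ 2 = 1.
Proof. by have /andP[/eqP] := xchooseP (mx_subproof F). Qed.

Lemma mx1 : eqpm (mx 1%g) 1.
Proof. by apply: mx_uniq represents1; rewrite det1. Qed.

Lemma mxM F G : eqpm (mx (F * G)%g) (mx F * mx G).
Proof.
apply: mx_uniq; first by rewrite det_mulmx exprMn !det_mx_sq.
exact: representsM (represents_mx F) (represents_mx G).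
Qed.

(** All row norms of the identity are 1, which excludes a peak; hence the components are
    variables. *)
Lemma mx_eq1 F : eqpm (mx F) 1 -> F = 1%g.
Proof.
have [A FA [detA nfA]] := trace_map_normal_form F => mxF1.
have A1 : eqpm A 1 by apply: eqpm_trans mxF1; apply/eqpm_sym/mx_uniq.
have norm1 k : row_norm A k = 1.
  by case: A1 => ->; rewrite mx2_1 ?mx2N; elim/ord3_ind: k; rewrite row_norm_mx2.
case: nfA => [base|]; last by case=> -[_ + _]; rewrite !norm1 ltxx.
apply: trace_map_eq => k; rewrite component1; have [[l Fl] _] := base k.
(* At this point the coordinates are T_1, T_2, T_3 = 2, 7, 26, which are distinct and so identify
   each variable. *)
have := represents_eqpm FA (eqpm_sym A1) 1 2 k.
rewrite Fl mevalXU mx2_1 !mx2E => Elk; congr 'X_ _.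
by move: Elk; elim/ord3_ind: l {Fl}; elim/ord3_ind: k.
Qed.

(** * The group of trace maps and its surjection onto PGL(2,Z) *)

Lemma trace_map_inverse (F : trace_map) :
  exists F', ((F * F' == 1) && (F' * F == 1))%g.
Proof.
suff [F' [FF' F'F]] : exists F', is_inverse F F'.
  by exists F'; rewrite FF' F'F !eqxx.
have step (g g' F1 F1' : trace_map) : is_inverse g g' -> is_inverse F1 F1' ->
    is_inverse (g * F1)%g (F1' * g')%g.
  move=> [gg' g'g] [FF' F'F]; split.
    by rewrite mulgA -(mulgA g) FF' mulg1.
  by rewrite mulgA -(mulgA F1') g'g mulg1.
elim/trace_map_ind: F => [|F [F' FF']|F [F' FF']|F [F' FF'] _].
- by exists 1%g; split; rewrite mul1g.
- by exists (F' * swap)%g; apply: step => //; split; exact: swap_sq.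
- exists (F' * (rotation * rotation))%g; apply: step => //; split.
    exact: rotation_cube.
  by rewrite -mulgA rotation_cube.
- by exists (F' * flip)%g; apply: step => //; split; exact: flip_sq.
Qed.

Definition trace_map_inv (F : trace_map) := xchoose (trace_map_inverse F).

HB.instance Definition _ := hasInv.Build trace_map trace_map_inv.

Fact trace_map_mulVg : left_inverse 1%g trace_map_inv *%g.
Proof. by move=> F; have /andP[_ /eqP] := xchooseP (trace_map_inverse F). Qed.

Fact trace_map_mulgV : right_inverse 1%g trace_map_inv *%g.
Proof. by move=> F; have /andP[/eqP] := xchooseP (trace_map_inverse F). Qed.

HB.instance Definition _ :=
  Monoid_isGroup.Build trace_map trace_map_mulVg trace_map_mulgV.

Definition realized a b c d := exists F, represents F (mx2 a b c d).

Lemma realizedN a b c d : realized a b c d -> realized (- a) (- b) (- c) (- d).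
Proof. by case=> F FA; exists F; rewrite -mx2N; apply: representsN. Qed.

Lemma realized_swap a b c d : realized a b c d -> realized c d a b.
Proof.
case=> F FA; exists (swap * F)%g; have := representsM represents_swap FA.
by rewrite mx2M !mul0r !mul1r !add0r !addr0.
Qed.

Lemma realized_rotation a b c d :
  realized a b c d -> realized c d (- a - c) (- b - d).
Proof.
case=> F FA; exists (rotation * F)%g; have := representsM represents_rotation FA.
by rewrite mx2M !mul0r !mul1r !add0r !mulN1r.
Qed.

Lemma realized_flip a b c d :
  realized a b c d -> realized (- a - 2 * c) (- b - 2 * d) c d.
Proof.
case=> F FA; exists (flip * F)%g; have := representsM represents_flip FA.
by rewrite mx2M !mul0r !mul1r !add0r !mulN1r !mulNr.
Qed.

(** A word in the three generators which performs an elementary row operation; with [realized_swap]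
    and sign changes these suffice for Euclid's algorithm. *)
Lemma realizedD a b c d : realized a b c d -> realized a b (a + c) (b + d).
Proof.
move/realized_rotation/realized_flip/realized_rotation/realizedN/realized_swap.
by congr realized; ring.
Qed.

Lemma realizedNr a b c d : realized a b c d -> realized a b (- c) (- d).
Proof.
by move/realized_swap/realized_rotation/realizedD; congr realized; ring.
Qed.

Lemma realizedB a b c d : realized a b c d -> realized a b (c - a) (d - b).
Proof. by move/realizedNr/realizedD/realizedNr; congr realized; ring. Qed.

Lemma sqr_mul_eq1 (a d : int) :
  (a * d) ^+ 2 = 1 -> (a = 1 \/ a = -1) /\ (d = 1 \/ d = -1).
Proof.
move=> E; have : ((`|a| * `|d|) ^ 2 == 1 ^ 2)%N by rewrite -abszM -abszX E.
rewrite eqn_exp2r // muln_eq1.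
by case/andP => /eqP a1 /eqP d1; split; lia.
Qed.

Lemma realized_upper a b d : (a * d) ^+ 2 = 1 -> realized a b 0 d.
Proof.
have [n] := ubnP `|b|%N; elim: n => // n IH in b *; rewrite ltnS => le_bn.
move=> ad1; have [a1 d1] := sqr_mul_eq1 ad1.
have [->|b0] := eqVneq b 0.
  have r1 : realized 1 0 0 1 by exists 1%g; rewrite -mx2_1; apply: represents1.
  have /realizedNr r2 := r1; rewrite oppr0 in r2.
  case: a1 d1 => -> [] -> //; first [exact: realizedN r1 | exact: realizedN r2].
have [lt_b|lt_b] : (absz (b - d)%R < `|b|)%N \/ (absz (b + d)%R < `|b|)%N by lia.
  have /realized_swap/realizedD/realized_swap := IH _ (leq_trans lt_b le_bn) ad1.
  by congr realized; ring.
have /realized_swap/realizedB/realized_swap := IH _ (leq_trans lt_b le_bn) ad1.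
by congr realized; ring.
Qed.

(** Euclid's algorithm on the first column: |a| + |c| decreases until the matrix is upper
    triangular, up to a swap of rows. *)
Lemma realized_unimodular a b c d : (a * d - b * c) ^+ 2 = 1 -> realized a b c d.
Proof.
have [n] := ubnP (`|a| + `|c|)%N; elim: n => // n IH in a b c d *.
rewrite ltnS => le_n det1.
have [c0|c0] := eqVneq c 0.
  by rewrite c0 in det1 *; apply: realized_upper; rewrite mulr0 subr0 in det1.
wlog le_ac : a b c d le_n det1 c0 / (`|a| <= `|c|)%N.
  move=> W; have [le_ac|lt_ca] := leqP `|a|%N `|c|%N; first exact: W.
  apply/realized_swap/W; [by rewrite addnC | by rewrite -det1; ring | lia |].
  exact: ltnW.
have [a0|a0] := eqVneq a 0.
  apply: realized_swap; rewrite a0 in det1 *; apply: realized_upper.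
  by rewrite -det1; ring.
have [lt_c|lt_c] : (absz (c - a)%R < `|c|)%N \/ (absz (c + a)%R < `|c|)%N by lia.
  have /IH : (`|a| + absz (c - a)%R < n)%N by lia.
  move=> /(_ b (d - b)) /(_ _)/realizedD; rewrite ![_ + (_ - _)]addrC !subrK; apply.
  by rewrite -det1; ring.
have /IH : (`|a| + absz (c + a)%R < n)%N by lia.
move=> /(_ b (d + b)) /(_ _)/realizedB; rewrite !addrK; apply.
by rewrite -det1; ring.
Qed.

Lemma mx_surj A : \det A ^+ 2 = 1 -> exists F, eqpm (mx F) A.
Proof.
elim/mx2_ind: A => a b c d detA; have := detA; rewrite det_mx2.
by move/realized_unimodular => [F FA]; exists F; apply: mx_uniq.
Qed.

(** * Commuting integer matrices *)

Definition mx2_simp :=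
  (mx2M, mx2D, mx2N, mx2Z, mx2_scalar, mx2_1, tr_mx2, det_mx2).

(** The bilinear form of the Cayley-Hamilton identity in dimension two. *)
Lemma polarization (A B : 'M[int]_2) :
  A * B + B * A
    = \tr A *: B + \tr B *: A + (\tr (A * B) - \tr A * \tr B)%:M.
Proof.
elim/mx2_ind: A => a b c d; elim/mx2_ind: B => a' b' c' d'.
by rewrite !mx2_simp; congr mx2; ring.
Qed.

Lemma cayley_hamilton2 (A : 'M[int]_2) : A * A = \tr A *: A - (\det A)%:M.
Proof. by elim/mx2_ind: A => a b c d; rewrite !mx2_simp; congr mx2; ring. Qed.

(** The adjugate, which is linear in A in dimension two; for determinant 1 or -1 it is the inverse
    up to sign. *)
Definition adj2 (A : 'M[int]_2) : 'M[int]_2 := (\tr A)%:M - A.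

Lemma mul_adj2 A : A * adj2 A = (\det A)%:M.
Proof. by rewrite /adj2; elim/mx2_ind: A => a b c d; rewrite !mx2_simp; congr mx2; ring. Qed.

Lemma mul_adj2l A : adj2 A * A = (\det A)%:M.
Proof. by rewrite /adj2; elim/mx2_ind: A => a b c d; rewrite !mx2_simp; congr mx2; ring. Qed.

Lemma tr_adj2 A : \tr (adj2 A) = \tr A.
Proof. by rewrite /adj2; elim/mx2_ind: A => a b c d; rewrite !mx2_simp; ring. Qed.

Lemma mulmx2_scalarl (a : int) (A : 'M[int]_2) : a%:M * A = a *: A.
Proof. exact: mul_scalar_mx. Qed.

(* The two equations say that the traceless matrix B = [[x, y], [z, -x]] is
   unimodular and that tr (A B) = 0, where A = [[a, b], [c, d]] and h = a - d,
   so that B A = adj(A) B. *)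
Lemma reversor_vector (h b c : int) :
  h ^+ 2 + 4 * b * c \in [:: 4; -4; -3] ->
  exists x y z, h * x + b * z + c * y = 0 /\ (x ^+ 2 + y * z) ^+ 2 = 1.
Proof.
have [n] := ubnP `|h|%N; elim: n => // n IH in h b c *.
rewrite ltnS => le_n disc.
wlog le_bc : b c disc / (`|b| <= `|c|)%N.
  move=> W; have [le_bc|lt_cb] := leqP `|b|%N `|c|%N; first exact: W.
  have [||x [y [z [E1 E2]]]] := W c b; [by rewrite mulrAC | exact: ltnW |].
  by exists x, z, y; split; [rewrite -E1 addrAC | rewrite mulrC].
have [b0|b0] := eqVneq b 0.
  have [e [h2 e2]] : exists e, h = 2 * e /\ (e = 1 \/ e = -1).
    have h4 : h ^+ 2 = 4 by move: disc; rewrite b0 !inE; nia.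
    have [h2|h2] : h = 2 \/ h = -2 by nia.
      by exists 1; split; [|left].
    by exists (-1); split; [|right].
  (* The linear equation is now 2ex + cy = 0: y is 1 or 2 according to the parity of c, and z is
     chosen to make x^2 + yz equal to 1. *)
  pose k := (c %/ 2)%Z; have [ck|ck] : c = 2 * k \/ c = 2 * k + 1 by rewrite /k; lia.
    exists (- k * e), 1, (1 - k ^+ 2).
    by case: e2 h2 => -> ->; rewrite b0 ck; split; ring.
  exists (- c * e), 2, (- 2 * k ^+ 2 - 2 * k).
  by case: e2 h2 => -> ->; rewrite b0 ck; split; ring.
(* Conjugation by a lower unipotent matrix changes h by 2b or -2b and keeps b and the discriminant;
   the solution found is conjugated back. *)
have [lt_bh|le_hb] := ltnP `|b|%N `|h|%N.
  have [lt_h|lt_h] : (absz (h + 2 * b)%R < `|h|)%N \/ (absz (h - 2 * b)%R < `|h|)%N by lia.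
    have [|x [y [z [E1 E2]]]] := IH _ b (c - h - b) (leq_trans lt_h le_n).
      by rewrite (_ : (h + 2 * b) ^+ 2 + 4 * b * (c - h - b) = h ^+ 2 + 4 * b * c) //; ring.
    exists (x - y), y, (z + 2 * x - y).
    by split; [rewrite -E1; ring | rewrite (_ : _ + y * _ = x ^+ 2 + y * z) //; ring].
  have [|x [y [z [E1 E2]]]] := IH _ b (c + h - b) (leq_trans lt_h le_n).
    by rewrite (_ : (h - 2 * b) ^+ 2 + 4 * b * (c + h - b) = h ^+ 2 + 4 * b * c) //; ring.
  exists (x + y), y, (z - 2 * x - y).
  by split; [rewrite -E1; ring | rewrite (_ : _ + y * _ = x ^+ 2 + y * z) //; ring].
(* In the reduced case |h| <= |b| <= |c| the given discriminants leave h = 0, or h = 1 or -1 with c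
   = -b. *)
have le_hbc : h ^+ 2 <= `|b * c|.
  rewrite normrM -real_normK ?num_real // expr2 ler_pM //; lia.
have h1 : h = 0 \/ h = 1 \/ h = -1 by move: disc; rewrite !inE; nia.
have bc1 : b * c = 1 \/ b * c = -1.
  by case: h1 disc le_hbc => [->|[->|->]]; rewrite !inE; lia.
have {}bc1 : (b * c) ^+ 2 = 1 by case: bc1 => ->.
have [b1 c1] := sqr_mul_eq1 bc1.
case: h1 disc => [->|h1]; first by exists 1, 0, 0; split; ring.
rewrite !inE => disc; exists 0, 1, 1; split; last by [].
by case: b1 c1 h1 disc => [->|->] [->|->] [->|->]; lia.
Qed.

Lemma sq_eq1 (d : int) : d ^+ 2 = 1 -> d = 1 \/ d = -1.
Proof. by move/eqP; rewrite sqrf_eq1 => /orP[]/eqP->; [left | right]. Qed.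

Lemma scale_mx_inj (k : int) : k != 0 -> injective ( *:%R k : 'M[int]_2 -> _).
Proof.
move=> k0 A B /matrixP AB; apply/matrixP => i j.
by move: (AB i j); rewrite !mxE; apply: mulfI.
Qed.

(** Anticommutation makes A conjugate to -A, so tr A = -tr A; the adjugate of X replaces its
    inverse. *)
Lemma anticommuting_tr0 (A X : 'M[int]_2) :
  \det X ^+ 2 = 1 -> A * X = - (X * A) -> \tr A = 0.
Proof.
move=> detX AX; have X0 : \det X != 0 by apply/eqP => X0; rewrite X0 in detX.
have : \tr (A * X * adj2 X) = - \tr (adj2 X * X * A).
  by rewrite AX mulNr raddfN /=; congr (- _); rewrite -(mulrA (adj2 X)); apply: mxtrace_mulC.
rewrite -mulrA mul_adj2 mul_adj2l mulmx2_scalarl mxtraceZ.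
rewrite [A * _]mul_mx_scalar mxtraceZ => E.
apply: (mulfI X0); rewrite mulr0; move: E; set y := _ * _; lia.
Qed.

Lemma sum_sq_pm4 (d t s : int) : d ^+ 2 = 1 ->
  t ^+ 2 + d * s ^+ 2 = 4 \/ t ^+ 2 + d * s ^+ 2 = -4 ->
  s = 0 /\ (t = 2 \/ t = -2) \/ t = 0 /\ (s = 2 \/ s = -2).
Proof.
move=> d2 E; have {}d2 := sq_eq1 d2.
have [t_le s_le] : -4 <= t <= 4 /\ -4 <= s <= 4.
  case: d2 E => -> E; first by split; apply/andP; split; nia.
  (* For d = -1 the form factors as (t - s)(t + s), and both factors divide 4. *)
  have bound (u v : int) : u * v = 4 \/ u * v = -4 -> -4 <= u <= 4.
    move=> uv; have uv4 : (`|u| * `|v| = 4)%N by rewrite -abszM; case: uv => ->.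
    by have : (`|u| <= 4)%N; [rewrite dvdn_leq // -uv4 dvdn_mulr | lia].
  have tsE : (t - s) * (t + s) = t ^+ 2 + -1 * s ^+ 2 by ring.
  have := bound (t + s) (t - s); have := bound (t - s) (t + s).
  by rewrite (mulrC (t + s)) tsE => /(_ E) ? /(_ E) ?; lia.
have [t_cases s_cases] : t \in [:: -4; -3; -2; -1; 0; 1; 2; 3; 4] /\
  s \in [:: -4; -3; -2; -1; 0; 1; 2; 3; 4] by rewrite !inE; lia.
move: t_cases s_cases d2 E {t_le s_le}; rewrite !inE.
do 8?[case/orP]; move=> /eqP->; do 8?[case/orP]; move=> /eqP-> [] ->; lia.
Qed.

(** Since A^2 = -d, polarization gives 2X = t - d s A with t = tr X and s = tr (A X). Taking
    determinants, t^2 + d s^2 = 4 det X, so one of s and t vanishes and the other is 2 or -2. *)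
Lemma tr0_commuting (A X : 'M[int]_2) :
  \tr A = 0 -> \det A ^+ 2 = 1 -> \det X ^+ 2 = 1 -> A * X = X * A ->
  eqpm X 1 \/ eqpm X A.
Proof.
move=> trA detA detX AX; set d := \det A in detA.
set t := \tr X; set s := \tr (A * X).
have E : 2 *: X = t%:M - (d * s) *: A.
  have AA : A * A = (- d)%:M by rewrite cayley_hamilton2 trA scale0r sub0r -raddfN.
  have -> : 2 *: X = (- d) *: (A * (A * X + A * X)).
    rewrite mulrDr mulrA AA mulmx2_scalarl -scalerDl scalerA.
    by congr (_ *: X); transitivity (2 * d ^+ 2); [rewrite detA | ring].
  have := polarization A X; rewrite trA -AX scale0r add0r mul0r subr0 -/t -/s => ->.
  rewrite mulrDr -scalerAr AA [A * _]mul_mx_scalar scalerDr !scalerA scale_scalar_mx.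
  rewrite -scaleNr -[in RHS]mulNr; congr (_%:M + _).
  by transitivity (t * d ^+ 2); [ring | rewrite detA mulr1].
have detE : t ^+ 2 + d * s ^+ 2 = 4 * \det X.
  transitivity (\det (2 *: X)); last first.
    by elim/mx2_ind: (X) => *; rewrite !mx2_simp; ring.
  transitivity (t ^+ 2 + d * d ^+ 2 * s ^+ 2); first by rewrite detA mulr1.
  rewrite E /d; move: (t) (s) trA => t' s'; elim/mx2_ind: (A) => a b c e.
  by rewrite !mx2_simp => /eqP; rewrite addr_eq0 => /eqP ->; ring.
have ts : t ^+ 2 + d * s ^+ 2 = 4 \/ t ^+ 2 + d * s ^+ 2 = -4.
  by rewrite detE; have [->|->] := sq_eq1 detX; [left|right].
have two0 : 2 != 0 :> int by [].
case: (sum_sq_pm4 detA ts) => -[E1 E2].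
- left; rewrite E1 mulr0 scale0r subr0 in E.
  case: E2 E => -> E; [left|right]; apply: (scale_mx_inj two0); rewrite E.
    by rewrite scale_scalar_mx mulr1.
  by rewrite scalerN scale_scalar_mx mulr1 -raddfN.
- right; rewrite E1 raddf0 sub0r -scaleNr in E.
  have d1 := sq_eq1 detA.
  by case: d1 E2 E => -> [] -> E; [right|left|left|right];
    apply: (scale_mx_inj two0); rewrite E ?scalerN -?scaleNr.
Qed.

(** * Discriminants and centralizers *)

Definition disc (A : 'M[int]_2) : int := \tr A ^+ 2 - 4 * \det A.

(** Twice the traceless part of A, the factor keeping the entries integral. *)
Definition centered (A : 'M[int]_2) : 'M[int]_2 := 2 *: A - (\tr A)%:M.

Lemma centered_sq A : centered A * centered A = (disc A)%:M.
Proof.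
rewrite /centered /disc; elim/mx2_ind: A => a b c d; rewrite !mx2_simp.
by congr mx2; ring.
Qed.

Lemma tr_centered A : \tr (centered A) = 0.
Proof. by rewrite /centered; elim/mx2_ind: A => a b c d; rewrite !mx2_simp; ring. Qed.

Lemma centered_comm (A X : 'M[int]_2) :
  A * X = X * A -> centered A * centered X = centered X * centered A.
Proof.
move=> AX; apply: comm_mxB; last exact: comm_mx_scalar.
apply: comm_mx_sym; apply: comm_mxB; last exact: comm_mx_scalar.
by rewrite /comm_mx -!scalemxAl -!scalemxAr; do 2!congr (_ *: _); exact/esym.
Qed.

(** Commuting traceless matrices W and Z are proportional: polarization reads 2WZ = s, and
    multiplying by W or Z gives the two relations. *)
Lemma centered_commuting (A X : 'M[int]_2) : A * X = X * A -> exists s,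
  [/\ (2 * disc A) *: centered X = s *: centered A,
      (2 * disc X) *: centered A = s *: centered X,
      s ^+ 2 = 4 * disc A * disc X & s = \tr (centered A * centered X)].
Proof.
move=> /centered_comm WZ; set W := centered A in WZ *; set Z := centered X in WZ *.
have := polarization W Z; rewrite -WZ !tr_centered !scale0r mul0r !add0r subr0.
set s := \tr _ => E; exists s.
have WW : W * W = (disc A)%:M := centered_sq A.
have ZZ : Z * Z = (disc X)%:M := centered_sq X.
have eZ : (2 * disc A) *: Z = s *: W.
  have <- : W * s%:M = s *: W by exact: mul_mx_scalar.
  by rewrite -E (mulrDr W) (mulrA W) WW mulmx2_scalarl -scalerDl mulr2n mulrDl mul1r.
have eW : (2 * disc X) *: W = s *: Z.
  have <- : Z * s%:M = s *: Z by exact: mul_mx_scalar.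
  by rewrite -E WZ (mulrDr Z) (mulrA Z) ZZ mulmx2_scalarl -scalerDl mulr2n mulrDl mul1r.
split=> //.
have : (s *: W) * Z + (s *: W) * Z = (s ^+ 2)%:M.
  by rewrite -!scalerAl -scalerDr E scale_scalar_mx.
rewrite -eZ -scalerAl ZZ -scalerDr -raddfD /= scale_scalar_mx.
by move=> /matrixP /(_ 0 0); rewrite !mxE /= !mulr1n => <-; ring.
Qed.

Lemma centered_eq0 X : \det X ^+ 2 = 1 -> centered X = 0 -> eqpm X 1.
Proof.
elim/mx2_ind: X => a b c d.
have mx2_0 : 0 = mx2 0 0 0 0 by rewrite -mx2_scalar raddf0.
rewrite /centered mx2_1 mx2_0 !mx2_simp => det1 /mx2_inj[E1 E2 E3 E4].
have [b0 c0 ad] : [/\ b = 0, c = 0 & d = a] by split; lia.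
subst b c d; move: det1; rewrite mulr0 subr0 => /sqr_mul_eq1[[->|->] _].
  by left.
by right; rewrite mx2N oppr0.
Qed.

(** The square s^2 = 4 disc(A) disc(X) is at most 0, so s = 0 and X has no traceless part. *)
Lemma hyperbolic_commuting (A X : 'M[int]_2) :
  0 < disc A -> disc X <= 0 -> A * X = X * A -> \det X ^+ 2 = 1 -> eqpm X 1.
Proof.
move=> discA discX /centered_commuting[s [E _ s2 _]] detX.
have s0 : s = 0 by nia.
apply: centered_eq0 => //; apply: (@scale_mx_inj (2 * disc A)); first by lia.
by rewrite E s0 scale0r scaler0.
Qed.

Lemma parabolic_commuting (A X : 'M[int]_2) :
  disc A = 0 -> ~ eqpm A 1 -> A * X = X * A -> \det A ^+ 2 = 1 -> disc X = 0.
Proof.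
move=> discA A1 /centered_commuting[s [_ E s2 _]] detA.
have s0 : s = 0 by move: s2; rewrite discA mulr0 mul0r; lia.
have [//|discX] := eqVneq (disc X) 0; case: A1; apply: centered_eq0 => //.
apply: (@scale_mx_inj (2 * disc X)); first by lia.
by rewrite E s0 scale0r scaler0.
Qed.

(** Here s^2 = 12 (4 det X - (tr X)^2). This is a square only if det X = 1 and either tr X = 2 or -2
    with s = 0, or tr X = 1 or -1 with s = 6 or -6; tr X = 0 would give 48. In the second case the
    traceless parts of X and A agree up to sign, and comparing traces decides between A and its
    adjugate. *)
Lemma tr1_commuting (A X : 'M[int]_2) : \det A = 1 -> \tr A ^+ 2 = 1 ->
  \det X ^+ 2 = 1 -> A * X = X * A ->
  [\/ eqpm X 1, eqpm X A | eqpm X (adj2 A)].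
Proof.
move=> detA trA detX /centered_commuting[s [E _ + _]].
have discA : disc A = -3 by rewrite /disc trA detA.
rewrite {}discA in E *; rewrite /disc => s2.
have t_cases : \tr X = 0 \/ \tr X = 1 \/ \tr X = -1 \/ \tr X = 2 \/ \tr X = -2.
  by have [d1|d1] := sq_eq1 detX; rewrite d1 in s2; nia.
have six0 : 2 * -3 != 0 :> int by [].
have s_cases : s = 0 \/ (\tr X = 1 \/ \tr X = -1) /\ (s = 6 \/ s = -6).
  have s_le : -7 < s < 7.
    by have [d1|d1] := sq_eq1 detX; rewrite d1 in s2; apply/andP; split; nia.
  have : s \in [:: -6; -5; -4; -3; -2; -1; 0; 1; 2; 3; 4; 5; 6].
    by rewrite !inE; lia.
  have [d1|d1] := sq_eq1 detX; rewrite !inE; last by rewrite d1 in s2; nia.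
  rewrite d1 in s2 *; do 12?[case/orP] => /eqP sE; rewrite sE in s2 *;
    case: t_cases s2 => [->|[->|[->|[->|->]]]]; lia.
case: s_cases => [s0|[{}t_cases s6]].
  constructor 1; apply: centered_eq0 => //; apply: (scale_mx_inj six0).
  by rewrite E s0 scale0r scaler0.
have {E} : centered X = centered A \/ centered X = - centered A.
  case: s6 E => -> E; [right|left]; apply: (scale_mx_inj six0); rewrite E //.
  by rewrite scalerN -scaleNr.
have two0 : 2 != 0 :> int by [].
rewrite /centered /adj2.
have trA_cases := sq_eq1 trA.
case=> /(canRL (subrK _)) E.
- have [tXA|tXA] : \tr X = \tr A \/ \tr X = - \tr A.
    by case: trA_cases t_cases => -> [] ->; [left|right|right|left].
  + by constructor 2; left; apply: (scale_mx_inj two0); rewrite E tXA subrK.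
  + constructor 3; right; apply: (scale_mx_inj two0); rewrite E tXA.
    rewrite opprB scalerBr scale_scalar_mx raddfN -addrA -opprD -raddfD /=.
    by congr (_ - _%:M); ring.
- have [tXA|tXA] : \tr X = \tr A \/ \tr X = - \tr A.
    by case: trA_cases t_cases => -> [] ->; [left|right|right|left].
  + constructor 3; left; apply: (scale_mx_inj two0); rewrite E tXA opprB.
    rewrite scalerBr scale_scalar_mx addrAC -raddfD /=.
    by congr (_%:M - _); ring.
  + constructor 2; right; apply: (scale_mx_inj two0).
    by rewrite E tXA scalerN raddfN opprB addrAC subrr sub0r.
Qed.

(* The truncated subtraction makes the size positive exactly for hyperbolic
   unimodular matrices: for the others tr (X^2) is -2, -1 or 2. *)
Definition trace_size (X : 'M[int]_2) : nat := (`|\tr (X * X)| - 2)%N.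

(** The size for parabolic matrices, where [trace_size] vanishes: a symmetric matrix of discriminant
    0 is scalar. *)
Definition skew_size (X : 'M[int]_2) : nat := absz (X 0 1 - X 1 0)%R.

Lemma tr_sq (X : 'M[int]_2) : \tr (X * X) = \tr X ^+ 2 - 2 * \det X.
Proof. by elim/mx2_ind: X => *; rewrite !mx2_simp; ring. Qed.

(* For unimodular commuting P and Q of traces T and T0, the Fricke identity makes
   u = tr (P Q) and v = tr (P Q^-1) the two roots of a quadratic polynomial which
   is negative at T. *)
Lemma markov_descent (T T0 u v : int) : 2 < T0 -> T0 <= T -> u + v = T * T0 ->
  (u - v) ^+ 2 = (T ^+ 2 - 4) * (T0 ^+ 2 - 4) ->
  (`|u| < `|T|)%N \/ (`|v| < `|T|)%N.
Proof.
move=> T0_gt2 le_T0T uv_sum uv_diff.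
have uv : u * v = T ^+ 2 + T0 ^+ 2 - 4.
  have four0 : 4 != 0 :> int by [].
  apply: (mulfI four0); transitivity ((u + v) ^+ 2 - (u - v) ^+ 2); first by ring.
  by rewrite uv_sum uv_diff; ring.
have prod_lt0 : (T - u) * (T - v) < 0.
  rewrite (_ : _ * _ = T ^+ 2 - T * (u + v) + u * v); last by ring.
  rewrite uv_sum uv (_ : _ + _ = (T0 - 2) * (T0 + 2 - T ^+ 2)); last by ring.
  by rewrite pmulr_rlt0; nia.
have uv_gt0 : 0 < u * v by rewrite uv; nia.
have [lt_uT|le_Tu] := ltP u T.
  left; have v_gt : T - v < 0 by rewrite -(pmulr_rlt0 _ (_ : 0 < T - u)) //; lia.
  have : 0 < u by rewrite -(pmulr_lgt0 _ (_ : 0 < v)) //; lia.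
  by lia.
right; have lt_vT : 0 < T - v.
  move: prod_lt0; rewrite ltNge => /negP neg; rewrite ltNge.
  by apply/negP => ?; apply: neg; nia.
have : 0 < v by rewrite -(pmulr_rgt0 _ (_ : 0 < u)) //; lia.
by lia.
Qed.

(** Passing to the squares P and Q makes the determinants 1; [centered_commuting] for P and Q then
    supplies the difference of tr (P Q) and tr (P Q^-1) needed in [markov_descent]. *)
Lemma trace_size_descent (X Y : 'M[int]_2) :
  X * Y = Y * X -> \det X ^+ 2 = 1 -> \det Y ^+ 2 = 1 ->
  (0 < trace_size Y <= trace_size X)%N ->
  (trace_size (X * Y) < trace_size X)%N
  \/ (trace_size (X * adj2 Y) < trace_size X)%N.
Proof.
move=> XY detX detY; rewrite /trace_size.
(* Hence a positive size means a trace of the square above 2, not below -2. *)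
have tr_ge (Z : 'M[int]_2) : \det Z ^+ 2 = 1 -> -2 <= \tr (Z * Z).
  by move=> /sq_eq1 detZ; rewrite tr_sq; nia.
have adjXY : X * adj2 Y = adj2 Y * X.
  by rewrite /adj2 mulrBr mulrBl XY; congr (_ - _); apply: scalar_mxC.
set P := X * X; set Q := Y * Y.
have detP : \det P = 1 by rewrite det_mulmx.
have detQ : \det Q = 1 by rewrite det_mulmx.
have adjQ : adj2 Y * adj2 Y = adj2 Q.
  rewrite /Q /adj2; elim/mx2_ind: (Y) => *; rewrite !mx2_simp; congr mx2; ring.
have -> : X * Y * (X * Y) = P * Q by rewrite /P mulrA -(mulrA X) -XY !mulrA.
have -> : X * adj2 Y * (X * adj2 Y) = P * adj2 Q.
  by rewrite /P -adjQ mulrA -(mulrA X) -adjXY !mulrA.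
have PQ : P * Q = Q * P.
  have YP : GRing.comm Y P by apply: commrM.
  by apply: commrM; apply: commr_sym.
have [s [_ _ s2 sE]] := centered_commuting PQ.
have tr_sum : \tr (P * Q) + \tr (P * adj2 Q) = \tr P * \tr Q.
  rewrite /adj2; elim/mx2_ind: (P) => a b c d; elim/mx2_ind: (Q) => *.
  by rewrite !mx2_simp; ring.
have tr_diff : s = 2 * (\tr (P * Q) - \tr (P * adj2 Q)).
  rewrite sE /centered /adj2; elim/mx2_ind: (P) => a b c d; elim/mx2_ind: (Q) => *.
  by rewrite !mx2_simp; ring.
rewrite /disc detP detQ !mulr1 in s2.
have diff_sq : (\tr (P * Q) - \tr (P * adj2 Q)) ^+ 2
    = (\tr P ^+ 2 - 4) * (\tr Q ^+ 2 - 4).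
  have four0 : 4 != 0 :> int by [].
  apply: (mulfI four0); transitivity (s ^+ 2); first by rewrite tr_diff; ring.
  by rewrite s2; ring.
have := tr_ge X detX; have := tr_ge Y detY; rewrite -/P -/Q => geP geQ size_le.
move: (fun gt2 le => markov_descent gt2 le tr_sum diff_sq) geP geQ size_le
  => {tr_sum diff_sq s2 tr_diff sE}.
move: (\tr P) (\tr Q) (\tr (P * Q)) (\tr (P * adj2 Q)) => p q u v descent.
clear -descent => geP geQ size_le.
by have [||lt_u|lt_v] := descent; [lia | lia | left; lia | right; lia].
Qed.

(** Size 0 means det X = 1 with disc X <= 0, or det X = -1 with tr X = 0. In the latter case
    [tr0_commuting] with exchanged roles makes A equal to 1 or X up to sign, against its
    discriminant or its trace. *)
Lemma trace_size_eq0 (A X : 'M[int]_2) :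
  0 < disc A -> \tr A != 0 -> \det A ^+ 2 = 1 -> A * X = X * A ->
  \det X ^+ 2 = 1 -> trace_size X = 0%N -> eqpm X 1.
Proof.
move=> discA trA detA AX detX; rewrite /trace_size tr_sq => sizeX.
have [d1|d1] := sq_eq1 detX; rewrite d1 in sizeX.
  by apply: hyperbolic_commuting AX detX => //; rewrite /disc d1; lia.
have trX : \tr X = 0 by nia.
have [A1|AX'] := tr0_commuting trX detX detA (esym AX).
  move: discA; rewrite /disc.
  by case: A1 => ->; rewrite mx2_1 ?mx2N tr_mx2 det_mx2.
by move: trA; case: AX' => ->; rewrite ?raddfN /= trX ?oppr0 eqxx.
Qed.

(** By polarization w (X Y) is w X + w Y up to signs, and replacing Y by its adjugate reverses the
    sign of w Y. So one of the two sizes is the difference of those of X and Y. *)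
Lemma skew_size_descent (X Y : 'M[int]_2) :
  X * Y = Y * X -> \tr X ^+ 2 = 4 -> \tr Y ^+ 2 = 4 ->
  (0 < skew_size Y <= skew_size X)%N ->
  (skew_size (X * Y) < skew_size X)%N \/ (skew_size (X * adj2 Y) < skew_size X)%N.
Proof.
rewrite /skew_size; pose w (Z : 'M[int]_2) := Z 0 1 - Z 1 0; rewrite -!/(w _).
have wD Z Z' : w (Z + Z') = w Z + w Z' by rewrite /w !mxE; ring.
have wZ k Z : w (k *: Z) = k * w Z by rewrite /w !mxE; ring.
have wS k : w k%:M = 0 by rewrite /w !mxE.
have wM Z Z' : Z * Z' = Z' * Z -> 2 * w (Z * Z') = \tr Z * w Z' + \tr Z' * w Z.
  move=> ZZ'; have := congr1 w (polarization Z Z'); rewrite -ZZ'.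
  by rewrite !wD !wZ wS addr0 => <-; ring.
have wadj : w (adj2 Y) = - w Y by rewrite /adj2 -scaleN1r wD wS wZ add0r mulN1r.
move=> XY trX trY.
have adjXY : X * adj2 Y = adj2 Y * X.
  by rewrite /adj2 mulrBr mulrBl XY; congr (_ - _); apply: scalar_mxC.
have := wM _ _ XY; have := wM _ _ adjXY; rewrite wadj tr_adj2.
have {}trX : \tr X = 2 \/ \tr X = -2 by nia.
have {}trY : \tr Y = 2 \/ \tr Y = -2 by nia.
by case: trX => ->; case: trY => ->; lia.
Qed.

Lemma skew_size_eq0 (X : 'M[int]_2) :
  \det X = 1 -> \tr X ^+ 2 = 4 -> skew_size X = 0%N -> eqpm X 1.
Proof.
move=> detX trX sizeX; apply: centered_eq0; first by rewrite detX.
move: detX trX sizeX; rewrite /centered /skew_size.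
elim/mx2_ind: X => a b c d; rewrite !mx2E !mx2_simp => det1 tr4 bc.
have cb : c = b by lia.
have : (a - d) ^+ 2 + 4 * b ^+ 2 = 0 by rewrite cb in det1; lia.
move=> sq0; have [ad b0] : d = a /\ b = 0 by split; nia.
by rewrite cb ad b0; apply/matrixP => i j; rewrite !mxE; do 2?case: ifP => _; ring.
Qed.

(** * Cyclic and dihedral groups *)

Definition zexpg (gT : groupType) (x : gT) (n : int) : gT :=
  match n with Posz k => (x ^+ k)%g | Negz k => (x ^- k.+1)%g end.

Lemma zexpg_subn (gT : groupType) (x : gT) (m n : nat) :
  zexpg x (m%:Z - n%:Z) = (x ^+ m / x ^+ n)%g.
Proof.
have [le_nm|lt_mn] := leqP n m.
  by rewrite -expgnFr // subzn.
rewrite -opprB subzn ?(ltnW lt_mn) // -(prednK (_ : 0 < n - m)%N) ?subn_gt0 //.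
rewrite -NegzE /= prednK ?subn_gt0 // expgnFr ?(ltnW lt_mn) //.
by rewrite invgF.
Qed.

Lemma zexpgD (gT : groupType) (x : gT) (a b : int) :
  zexpg x (a + b) = (zexpg x a * zexpg x b)%g.
Proof.
have diff (i : int) : exists m n : nat, i = m%:Z - n%:Z.
  by case: i => k; [exists k, 0%N | exists 0%N, k.+1]; lia.
have [m [n ->]] := diff a; have [p [q ->]] := diff b.
rewrite (_ : _ + _ = (m + p)%:Z - (n + q)%:Z); last by lia.
rewrite !zexpg_subn (addnC n) !expgnDr invgM !mulgA.
congr (_ * _)%g; rewrite -!mulgA; congr (_ * _)%g.
exact/commuteV/commuteX2/commute_refl.
Qed.

Lemma zexpgN (gT : groupType) (x : gT) (a : int) :
  zexpg x (- a) = (zexpg x a)^-1%g.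
Proof.
apply: (mulgI (zexpg x a)).
by rewrite -zexpgD subrr mulgV.
Qed.

Lemma zexpgM (gT : groupType) (x : gT) (a b : int) :
  zexpg (zexpg x a) b = zexpg x (a * b).
Proof.
have nat_case (k : nat) : (zexpg x a ^+ k)%g = zexpg x (a * k%:Z).
  elim: k => [|k IH]; first by rewrite mulr0.
  by rewrite expgS IH -zexpgD -[in RHS]add1n PoszD mulrDr mulr1.
case: b => k; first exact: nat_case.
by rewrite [LHS]/= nat_case NegzE mulrN zexpgN.
Qed.

(** An element u of least positive size generates: any other element is brought down to size 0,
    hence to 1, by repeated multiplication by u or its inverse. *)
Lemma cyclic_of_descent (gT : groupType) (C : gT -> Prop) (size : gT -> nat) :
  C 1%g -> (forall x y, C x -> C y -> C (x * y)%g) ->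
  (forall x y, C x -> C y -> C (x / y)%g) ->
  (forall x, C x -> size x = 0%N -> x = 1%g) ->
  (forall x y, C x -> C y -> (0 < size y <= size x)%N ->
     (size (x * y)%g < size x)%N \/ (size (x / y)%g < size x)%N) ->
  exists2 u, C u & forall x, C x -> exists n, x = zexpg u n.
Proof.
move=> C1 CM CF size0 descent.
have minimal n : (exists x, C x /\ (0 < size x <= n)%N) ->
    exists y, [/\ C y, (0 < size y)%N & forall z, C z -> (0 < size z)%N -> (size y <= size z)%N].
  elim: n => [[x [_]]|n IH [x [Cx /andP[x_gt0 le_x]]]].
    by rewrite andbC leqn0; case: (size x).
  have [small|big] := classic (exists x, C x /\ (0 < size x <= n)%N); first exact: IH.
  exists x; split=> // z Cz z_gt0; rewrite leqNgt; apply/negP => lt_zx.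
  by apply: big; exists z; rewrite z_gt0 -ltnS (leq_trans lt_zx).
have [[x [Cx x_gt0]]|trivial] := classic (exists x, C x /\ (0 < size x)%N).
  have [|u [Cu u_gt0 minu]] := minimal (size x); first by exists x; rewrite x_gt0 leqnn.
  exists u => // y; have [n] := ubnP (size y).
  elim: n => // n IH in y *; rewrite ltnS => le_yn Cy.
  have [y0|y_gt0] := posnP (size y).
    by exists 0; rewrite (size0 _ Cy y0).
  have [|lt_y|lt_y] := descent y u Cy Cu; first by rewrite u_gt0 minu.
    have [k Ek] := IH (y * u)%g (leq_trans lt_y le_yn) (CM _ _ Cy Cu).
    by exists (k - 1); rewrite zexpgD -Ek zexpgN mulgK.
  have [k Ek] := IH (y / u)%g (leq_trans lt_y le_yn) (CF _ _ Cy Cu).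
  by exists (k + 1); rewrite zexpgD -Ek mulgVK.
exists 1%g => // x Cx; exists 0; apply: size0 => //.
by case: (posnP (size x)) => // x_gt0; case: trivial; exists x.
Qed.

Lemma isomorphic_intro (gT : groupType) (M : monoidType) (A : M -> Prop)
    (f : gT -> M) :
  f 1%g = 1%g -> {morph f : x y / (x * y)%g} -> injective f ->
  (forall x, A x <-> exists g, f g = x) -> isomorphic_to A gT.
Proof.
move=> f1 fM f_inj fA.
pose fmul := isMultiplicative.Build gT M f fM.
pose fone := Multiplicative_isUMagmaMorphism.Build gT M f f1.
pose h : UMagmaMorphism.type gT M := HB.pack f fmul fone.
by exists h.
Qed.

Lemma isomorphic_dihedral (A : zmodType) (gT : groupType) (R : gT -> Prop)
    (e : A -> gT) (g : gT) :
  (forall a b, e (a + b) = (e a * e b)%g) -> injective e ->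
  (g * g = 1)%g -> (forall a, g * e a = e (- a) * g)%g -> (forall a, e a <> g) ->
  (forall x, R x <-> exists a, x = e a \/ x = (e a * g)%g) ->
  isomorphic_to R (dihedral A).
Proof.
move=> eD e_inj gg ge eg RE.
have e0 : e 0 = 1%g by apply: (mulgI (e 0)); rewrite -eD addr0 mulg1.
have eN a : e (- a) = (e a)^-1%g by apply: (mulgI (e a)); rewrite -eD subrr mulgV.
pose f (u : dihedral A) := (e u.1 * (if u.2 then g else 1))%g.
apply: (@isomorphic_intro _ _ _ f).
- by rewrite /f e0 mulg1.
- move=> [a s] [b t]; rewrite /f /=; case: s => /=.
    rewrite eD -!mulgA; congr (_ * _)%g; rewrite mulgA ge -mulgA.
    by case: t; rewrite /= ?gg ?mulg1.
  by rewrite eD mulg1 mulgA.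
- move=> [a [|]] [b [|]]; rewrite /f /= ?mulg1.
  + by move/mulIg/e_inj => ->.
  + by move=> E; case: (eg (b - a)); rewrite addrC eD eN -E mulKg.
  + by move=> E; case: (eg (a - b)); rewrite addrC eD eN E mulKg.
  + by move/e_inj => ->.
- move=> x; rewrite RE; split=> [[a [->|->]]|[[a s] <-]].
  + by exists (a, false); rewrite /f /= mulg1.
  + by exists (a, true).
  + by exists a; rewrite /f; case: s => /=; rewrite ?mulg1; [right|left].
Qed.

(** * Reversing symmetry groups *)

Lemma mx_inj F G : eqpm (mx F) (mx G) -> F = G.
Proof.
move=> FG; apply: divg1_eq; apply: mx_eq1; apply: eqpm_trans (mxM _ _) _.
apply: eqpm_trans (eqpmM FG (eqpm_refl _)) _; apply: eqpm_trans (eqpm_sym (mxM _ _)) _.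
by rewrite mulgV; apply: mx1.
Qed.

Lemma mxV F : eqpm (mx F^-1%g) (adj2 (mx F)).
Proof.
have FV : eqpm (mx F * mx F^-1%g) 1.
  by apply: eqpm_trans (eqpm_sym (mxM _ _)) _; rewrite mulgV; apply: mx1.
have := eqpmM (eqpm_refl (adj2 (mx F))) FV.
rewrite mulrA mul_adj2l mulr1 mulmx2_scalarl => VF; apply: (eqpm_trans _ VF).
by have [->|->] := sq_eq1 (det_mx_sq F); rewrite ?scale1r ?scaleN1r; [left|right; rewrite opprK].
Qed.

Lemma mx_commute F G : (F * G = G * F)%g ->
  mx F * mx G = mx G * mx F \/ mx F * mx G = - (mx G * mx F).
Proof.
move=> FG; suff: eqpm (mx F * mx G) (mx G * mx F) by [].
by apply: eqpm_trans (eqpm_sym (mxM F G)) _; rewrite FG; apply: mxM.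
Qed.

Lemma mx_commute_tr F G : \tr (mx F) != 0 -> (F * G = G * F)%g ->
  mx F * mx G = mx G * mx F.
Proof.
move=> trF /mx_commute[//|E]; move: trF.
by rewrite (anticommuting_tr0 (det_mx_sq G) E) eqxx.
Qed.

Lemma eqpm1_tr A : eqpm A 1 -> \tr A ^+ 2 = 4 /\ \det A = 1.
Proof. by case=> ->; rewrite mx2_1 ?mx2N tr_mx2 det_mx2. Qed.

(** A form without inverses, which is checked directly on matrices up to sign. *)
Lemma reversing_symmetryP F G : is_reversing_symmetry F G <-> (F * G * F = G)%g.
Proof.
split=> [[F' [G' [[FF' F'F] [GG' G'G] E]]]|E].
  have {E} : (G * F = F' * G)%g by rewrite -E -mulgA G'G mulg1.
  by move=> E; rewrite -mulgA E mulgA FF' mul1g.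
exists F^-1%g, G^-1%g; split; try by split; rewrite ?mulgV ?mulVg.
by apply: (mulgI F); rewrite !mulgA E !mulgV.
Qed.

Lemma rev_sym_groupP F G :
  rev_sym_group F G <-> (F * G = G * F)%g \/ (F * G * F = G)%g.
Proof. by rewrite /rev_sym_group reversing_symmetryP. Qed.

Lemma reversibleP F : reversible F <-> exists G, (F * G * F = G)%g.
Proof.
by split=> -[G FG]; exists G; move: FG; rewrite reversing_symmetryP.
Qed.

Lemma mx_reversor (A : 'M[int]_2) : disc A \in [:: 4; -4; -3] ->
  exists B, [/\ \det B ^+ 2 = 1, \tr B = 0 & B * A = adj2 A * B].
Proof.
elim/mx2_ind: A => a b c d discA.
have [|x [y [z [E1 E2]]]] := @reversor_vector (a - d) b c.
  rewrite (_ : (a - d) ^+ 2 + 4 * b * c = disc (mx2 a b c d)) //.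
  by rewrite /disc tr_mx2 det_mx2; ring.
exists (mx2 x y z (- x)); split.
- by rewrite det_mx2 -E2; ring.
- by rewrite tr_mx2 subrr.
- have E : c * y = - ((a - d) * x + b * z) by lia.
  by rewrite /adj2 !mx2_simp; congr mx2; [lia | ring | ring | lia].
Qed.

(** A traceless reversor squares to a scalar, so it gives an involution. The last clause keeps the
    exact matrix identity, whose sign matters in order 2. *)
Lemma finite_order_reversor F : disc (mx F) \in [:: 4; -4; -3] ->
  exists G, [/\ (G * G = 1)%g, (F * G * F = G)%g
    & mx G * mx F = adj2 (mx F) * mx G].
Proof.
move=> /mx_reversor[B [detB trB BA]]; have [G GB] := mx_surj detB.
have {}BA : mx G * mx F = adj2 (mx F) * mx G.
  by case: GB => ->; rewrite ?mulrN ?mulNr BA.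
exists G; split=> //; apply: mx_inj.
  apply: eqpm_trans (mxM _ _) _; apply: eqpm_trans (eqpmM GB GB) _.
  rewrite cayley_hamilton2 trB scale0r sub0r; apply: eqpm_trans (eqpm_sym mx1).
  by have [->|->] := sq_eq1 detB; [right | left; rewrite -raddfN opprK].
apply: eqpm_trans (mxM _ _) _; apply: eqpm_trans (eqpmM (mxM _ _) (eqpm_refl _)) _.
rewrite -mulrA BA mulrA mul_adj2 mulmx2_scalarl.
by have [->|->] := sq_eq1 (det_mx_sq F); rewrite ?scale1r ?scaleN1r; [left|right].
Qed.

Lemma tr0_order F : \tr (mx F) = 0 -> (F * F = 1)%g /\ F <> 1%g.
Proof.
move=> trF; split.
  apply: mx_inj; apply: eqpm_trans (mxM _ _) _.
  rewrite cayley_hamilton2 trF scale0r sub0r; apply: eqpm_trans (eqpm_sym mx1).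
  by have [->|->] := sq_eq1 (det_mx_sq F); [right | left; rewrite -raddfN opprK].
by move=> F1; have [+ _] := eqpm1_tr mx1; rewrite -F1 trF.
Qed.

(** Elements commuting with F have matrices which commute or anticommute with that of F. The former
    are 1 and F; since the reversor G anticommutes, multiplication by G turns the latter into the
    former. *)
Lemma tr0_centralizer F : \tr (mx F) = 0 -> exists G,
  [/\ (G * G = 1)%g, (F * G = G * F)%g, G <> 1%g /\ G <> F
    & forall x, (F * x = x * F)%g <-> [\/ x = 1%g, x = F, x = G | x = (F * G)%g]].
Proof.
move=> trF; have [FF F1] := tr0_order trF.
have [|G [GG FGF GA]] := @finite_order_reversor F.
  by rewrite /disc trF; have [->|->] := sq_eq1 (det_mx_sq F).
have FG : (F * G = G * F)%g by rewrite -{2}FGF -mulgA FF mulg1.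
have {}GA : mx G * mx F = - (mx F * mx G).
  by rewrite GA /adj2 trF raddf0 sub0r mulNr.
have G_nc : mx F * mx G <> mx G * mx F.
  move=> E; have : \det (mx F * mx G) ^+ 2 = 1.
    by rewrite det_mulmx exprMn !det_mx_sq.
  suff -> : mx F * mx G = 0 by rewrite det0.
  apply: (@scale_mx_inj 2) => //; rewrite scaler0 (scalerDl (mx F * mx G) 1 1) scale1r.
  by rewrite {2}E GA subrr.
exists G; split=> //.
  by split=> GE; apply: G_nc; rewrite GE //; have [->|->] := mx1;
     rewrite ?mulrN ?mulNr mulr1 mul1r.
move=> x; split; last first.
  case=> ->; rewrite ?mulg1 ?mul1g ?FG //.
  by rewrite mulgA FG.
have comm (y : trace_map) : mx F * mx y = mx y * mx F -> y = 1%g \/ y = F.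
  move=> /(tr0_commuting trF (det_mx_sq F) (det_mx_sq y))[y1|yF].
    by left; apply: mx_eq1.
  by right; apply: mx_inj.
move=> /mx_commute[/comm[]|E]; first by constructor 1.
  by constructor 2.
have : mx F * mx (x * G)%g = mx (x * G)%g * mx F.
  have key : mx F * (mx x * mx G) = mx x * mx G * mx F.
    by rewrite mulrA E mulNr -[RHS]mulrA GA mulrN mulrA.
  by have [->|->] := mxM x G; rewrite ?mulrN ?mulNr key.
move/comm=> [xG|xG]; [constructor 3|constructor 4].
  by rewrite -[x]mulg1 -GG mulgA xG mul1g.
by rewrite -[x]mulg1 -GG mulgA xG.
Qed.

Lemma tr1_order F : \det (mx F) = 1 -> \tr (mx F) ^+ 2 = 1 ->
  (F * (F * F) = 1)%g /\ F <> 1%g.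
Proof.
move=> detF trF; split; last first.
  by move=> F1; have [+ _] := eqpm1_tr mx1; rewrite -F1 trF.
have FF : mx F * mx F = \tr (mx F) *: mx F - 1 by rewrite cayley_hamilton2 detF.
apply: mx_inj; apply: eqpm_trans (mxM _ _) _.
apply: eqpm_trans (eqpmM (eqpm_refl _) (mxM _ _)) _.
apply: eqpm_trans (eqpm_sym mx1).
rewrite FF mulrBr mulr1 -scalerAr FF scalerBr scalerA -expr2 trF scale1r.
rewrite addrAC subrr sub0r.
by have [->|->] := sq_eq1 trF; rewrite ?scale1r ?scaleN1r ?opprK; [right|left].
Qed.

Lemma tr1_centralizer F x : \det (mx F) = 1 -> \tr (mx F) ^+ 2 = 1 ->
  (F * x = x * F)%g -> [\/ x = 1%g, x = F | x = (F * F)%g].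
Proof.
move=> detF trF Fx; have [FFF _] := tr1_order detF trF.
have trF0 : \tr (mx F) != 0 by apply/eqP => trF0; rewrite trF0 in trF.
have := tr1_commuting detF trF (det_mx_sq x) (mx_commute_tr trF0 Fx).
case=> [x1|xF|xV]; [constructor 1|constructor 2|constructor 3].
- exact: mx_eq1.
- exact: mx_inj.
- have -> : (F * F = F^-1)%g by apply: (mulgI F); rewrite FFF mulgV.
  by apply: mx_inj; apply: eqpm_trans xV (eqpm_sym (mxV F)).
Qed.

Lemma mxX F n : eqpm (mx (F ^+ n)%g) (mx F ^+ n).
Proof.
elim: n => [|n IH]; first exact: mx1.
rewrite expgS exprS; apply: eqpm_trans (mxM _ _) _.
exact: eqpmM (eqpm_refl _) IH.
Qed.

(** The traces of the powers satisfy t_(m+2) = t_1 t_(m+1) - t_m and increase strictly from t_0 =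
    2. *)
Lemma hyperbolic_tr (P : 'M[int]_2) n :
  \det P = 1 -> 2 < \tr P -> (0 < n)%N -> 2 < \tr (P ^+ n).
Proof.
move=> detP trP; case: n => // n _.
suff: 2 <= \tr (P ^+ n) /\ \tr (P ^+ n) < \tr (P ^+ n.+1) by lia.
have P2 m : \tr (P ^+ m.+2) = \tr P * \tr (P ^+ m.+1) - \tr (P ^+ m).
  rewrite !exprS mulrA cayley_hamilton2 detP mulrBl mul1r -scalerAl.
  by rewrite raddfB /= mxtraceZ.
elim: n => [|n [IH1 IH2]].
  by rewrite expr0 expr1 [X in \tr X]mx2_1 tr_mx2.
by rewrite P2; nia.
Qed.

Lemma centered_mulmx (A : 'M[int]_2) : centered (A * A) = \tr A *: centered A.
Proof. by rewrite /centered; elim/mx2_ind: A => *; rewrite !mx2_simp; congr mx2; ring. Qed.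

(** The square P of the matrix has determinant 1 and trace at least 2. If the trace exceeds 2, so do
    those of all positive powers; otherwise P is unipotent and P^n = 1 + n (P - 1), so that P^n = 1
    forces P = 1 and then the matrix of F to be scalar. *)
Lemma infinite_order F : F <> 1%g -> \tr (mx F) != 0 -> 0 <= disc (mx F) ->
  forall n, (0 < n)%N -> (F ^+ n <> 1)%g.
Proof.
move=> F1 trF discF n n_gt0 Fn.
set A := mx F in trF discF *; pose P := A * A.
have detP : \det P = 1 by rewrite det_mulmx; have := det_mx_sq F; rewrite expr2.
have Pn : P ^+ n = 1.
  have An : eqpm (A ^+ n) 1.
    by apply: eqpm_trans (eqpm_sym (mxX F n)) _; rewrite Fn; apply: mx1.
  rewrite /P -expr2 -exprM mulnC exprM.
  by case: An => ->; rewrite ?expr1n // sqrrN expr1n.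
have trP : \tr P = \tr A ^+ 2 - 2 * \det A by rewrite tr_sq.
have [trP_gt2|trP_le2] := ltP 2 (\tr P).
  by have := hyperbolic_tr detP trP_gt2 n_gt0; rewrite Pn mx2_1 tr_mx2.
have trP2 : \tr P = 2.
  move: trP trP_le2 discF trF; rewrite /disc.
  by have [->|->] := sq_eq1 (det_mx_sq F); nia.
have PP : (P - 1) * (P - 1) = 0.
  rewrite mulrBl mul1r mulrBr mulr1 cayley_hamilton2 trP2 detP.
  rewrite (scalerDl P 1 1) scale1r [X in X - (_ - _)]addrAC addrK.
  by rewrite opprB addrA subrK subrr.
have PnE : P ^+ n = 1 + n%:Z *: (P - 1).
  elim: (n) => [|k IH]; first by rewrite scale0r addr0.
  rewrite exprS -{1}[P](subrK 1) mulrDl mul1r IH mulrDr mulr1 -scalerAr PP scaler0 addr0.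
  by rewrite -(addn1 k) PoszD scalerDl scale1r addrC -addrA.
have P1 : P - 1 = 0.
  apply: (@scale_mx_inj n%:Z); first by rewrite -lt0n in n_gt0 *; lia.
  by apply: (addrI 1); rewrite scaler0 addr0 -PnE Pn.
apply: F1; apply: mx_eq1; apply: centered_eq0 (det_mx_sq F) _.
apply: (scale_mx_inj trF); rewrite -centered_mulmx -/P (subr0_eq P1) scaler0.
by apply/matrixP => i j; rewrite /centered mx2_1 !mx2_simp !mxE; do 2?case: ifP => _; ring.
Qed.

(** Over the rationals, the centralizer of a nonscalar A consists of polynomials in A. The
    denominator k is whichever of b, c and a - d is not 0. *)
Lemma commuting_affine (A X : 'M[int]_2) : centered A <> 0 ->
  A * X = X * A -> exists k p m, k != 0 /\ k *: X = p *: A + m%:M.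
Proof.
elim/mx2_ind: A => a b c d; elim/mx2_ind: X => x y z w.
rewrite !mx2M => A0 /mx2_inj[X1 X2 X3 _].
have [b0|b0] := eqVneq b 0; last first.
  exists b, y, (b * w - y * d); split=> //.
  by rewrite !mx2_simp; congr mx2; lia.
have [c0|c0] := eqVneq c 0; last first.
  exists c, z, (c * w - z * d); split=> //.
  by rewrite !mx2_simp; congr mx2; lia.
exists (a - d), (x - w), (a * w - x * d); split; last first.
  by rewrite !mx2_simp; congr mx2; lia.
apply/eqP => ad; apply: A0; rewrite /centered b0 c0 (_ : d = a); last by lia.
by apply/matrixP => i j; rewrite !mx2_simp !mxE; do 2?case: ifP => _; ring.
Qed.

Lemma centralizer_commutative (A X Y : 'M[int]_2) : centered A <> 0 ->
  A * X = X * A -> A * Y = Y * A -> X * Y = Y * X.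
Proof.
move=> A0 /(commuting_affine A0)[k [p [m [k0 E]]]] AY; apply: (scale_mx_inj k0).
rewrite scalerAl scalerAr E mulrDl mulrDr -scalerAl -scalerAr AY.
by congr (_ + _); apply/esym/scalar_mxC.
Qed.

(** A nonzero trace excludes anticommutation, so the matrices of the centralizer truly commute, with
    F and with each other. The descent uses [skew_size] for discriminant 0 and [trace_size]
    otherwise. *)
Lemma cyclic_centralizer F : F <> 1%g -> \tr (mx F) != 0 -> 0 <= disc (mx F) ->
  exists2 u, (F * u = u * F)%g &
    forall x, (F * x = x * F)%g -> exists n, x = zexpg u n.
Proof.
move=> F1 trF discF; pose C x := (F * x = x * F)%g.
have CM x y : C x -> C y -> C (x * y)%g.
  by rewrite /C => Fx Fy; rewrite mulgA Fx -mulgA Fy mulgA.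
have CV x : C x -> C (x^-1)%g by move=> Fx; apply: commuteV.
have CF x y : C x -> C y -> C (x / y)%g by move=> Cx /CV; apply: CM.
have C1 : C 1%g by rewrite /C mulg1 mul1g.
have commF x : C x -> mx F * mx x = mx x * mx F by apply: mx_commute_tr.
have A1 : ~ eqpm (mx F) 1 by move/mx_eq1.
have A0 : centered (mx F) <> 0 by move/(centered_eq0 (det_mx_sq F)).
have commC x y : C x -> C y -> mx x * mx y = mx y * mx x.
  by move=> /commF Cx /commF; apply: centralizer_commutative.
pose descends (size : 'M[int]_2 -> nat) := forall x y, C x -> C y ->
  (0 < size (mx y) <= size (mx x))%N ->
  (size (mx x * mx y)%R < size (mx x))%N \/ (size (mx x * adj2 (mx y))%R < size (mx x))%N.
(* A size insensitive to the sign carries a descent on matrices over to trace maps. *)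
have cyclic (size : 'M[int]_2 -> nat) : (forall X, size (- X) = size X) ->
    (forall x, C x -> size (mx x) = 0%N -> eqpm (mx x) 1) -> descends size ->
    exists2 u, C u & forall x, C x -> exists n, x = zexpg u n.
  move=> sizeN size0 desc.
  have size_eqpm X Y : eqpm X Y -> size X = size Y by case=> ->.
  apply: (@cyclic_of_descent _ C (size \o mx)) => // [x Cx /= x0|x y Cx Cy /= lt_yx].
    exact/mx_eq1/size0.
  have [lt_x|lt_x] := desc _ _ Cx Cy lt_yx; [left|right].
    by rewrite (size_eqpm _ _ (mxM x y)).
  by rewrite (size_eqpm _ _ (eqpm_trans (mxM _ _) (eqpmM (eqpm_refl _) (mxV y)))).
have [disc0|disc_neq0] := eqVneq (disc (mx F)) 0.
  have parabolic x : C x -> \det (mx x) = 1 /\ \tr (mx x) ^+ 2 = 4.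
    move=> /commF Fx; have := parabolic_commuting disc0 A1 Fx (det_mx_sq F).
    by rewrite /disc; have [->|->] := sq_eq1 (det_mx_sq x); nia.
  apply: (cyclic skew_size) => [X|x /parabolic[detx trx]|x y Cx Cy].
  - by rewrite /skew_size !mxE -abszN; congr absz; ring.
  - exact: skew_size_eq0.
  - have [[_ trx] [_ try]] := (parabolic x Cx, parabolic y Cy).
    by apply: skew_size_descent => //; apply: commC.
have disc_gt0 : 0 < disc (mx F) by rewrite lt_neqAle eq_sym disc_neq0.
apply: (cyclic trace_size) => [X|x /commF Fx|x y Cx Cy].
- by rewrite /trace_size mulrNN.
- exact: (trace_size_eq0 disc_gt0 trF (det_mx_sq F) Fx (det_mx_sq x)).
- by apply: trace_size_descent (det_mx_sq x) (det_mx_sq y); apply: commC.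
Qed.

Lemma expg_modn (gT : groupType) (x : gT) n k :
  (x ^+ n = 1 -> x ^+ (k %% n) = x ^+ k)%g.
Proof. by move=> xn; rewrite {2}(divn_eq k n) expgnDr mulnC expgnA xn expg1n mul1g. Qed.

Lemma Zp_expgD (gT : groupType) (x : gT) p (a b : 'I_p.+1) :
  (x ^+ p.+1 = 1 -> x ^+ (a + b)%R = x ^+ a * x ^+ b)%g.
Proof. by move=> xp; rewrite /= expg_modn // expgnDr. Qed.

Lemma mulgACA_commute (gT : groupType) (x y z w : gT) :
  commute y z -> (x * y * (z * w) = x * z * (y * w))%g.
Proof. by move=> yz; rewrite -!mulgA; congr (_ * _)%g; rewrite !mulgA yz. Qed.

(** Multiplication by a reversing involution exchanges symmetries and reversing symmetries. *)
Lemma reversing_centralizer (gT : groupType) (F G x : gT) :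
  (G * G = 1)%g -> (F * G * F = G)%g ->
  (F * x * F = x)%g <-> (F * (x * G) = x * G * F)%g.
Proof.
move=> GG FGF; have GF : (G * F = F^-1 * G)%g by rewrite -{2}FGF !mulgA mulVg mul1g.
rewrite -(mulgA x) GF !mulgA; split=> [E|/mulIg E].
  by congr (_ * G)%g; rewrite -{2}E mulgK.
by rewrite E mulgVK.
Qed.

Lemma tr0_isomorphic F : \tr (mx F) = 0 ->
  isomorphic_to (rev_sym_group F) D_2
  /\ isomorphic_to (rev_sym_group F) (C_2 * C_2)%type.
Proof.
move=> trF; have [FF F1] := tr0_order trF.
have [G [GG FG [G1 GF] centF]] := tr0_centralizer trF.
have RE x : rev_sym_group F x <-> exists a : 'Z_2, x = (F ^+ a)%g \/ x = (F ^+ a * G)%g.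
  rewrite rev_sym_groupP; split=> [Fx|].
    (* For an involution F, reversing symmetries are symmetries. *)
    have {Fx} /centF : (F * x = x * F)%g.
      by case: Fx => // E; rewrite -{2}E -mulgA FF mulg1.
    case=> ->; [exists 0; left|exists 1; left|exists 0; right|exists 1; right];
      by rewrite ?expg0 ?expg1 ?mul1g.
  by case=> -[[|[|//]] lta] /= [] ->; left; apply/centF; rewrite ?expg0 ?expg1 ?mul1g;
     [constructor 1|constructor 3|constructor 2|constructor 4].
have F2 : (F ^+ 2 = 1)%g := FF.
have eD (a b : 'Z_2) := Zp_expgD a b F2.
have e_inj : injective (fun a : 'Z_2 => F ^+ a)%g.
  have e0 (a : 'Z_2) : (F ^+ a = 1)%g -> a = 0.
    by case: a => -[|[|//]] lta E; [apply/val_inj | case: F1].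
  move=> a b /= E; apply: subr0_eq; apply: e0.
  by apply: (mulgI (F ^+ b)%g); rewrite -(eD b (a - b)) addrC subrK mulg1.
have eG (a : 'Z_2) : (F ^+ a <> G)%g.
  by case: a => -[|[|//]] lta /= E; [apply: G1 | apply: GF]; rewrite -E.
have ge (a : 'Z_2) : (G * F ^+ a = F ^+ (- a)%R * G)%g.
  have -> : - a = a by apply/val_inj; case: a => -[|[|//]].
  by apply: commuteX; apply/esym.
split; first exact: (isomorphic_dihedral eD e_inj GG ge eG RE).
have G2 : (G ^+ 2 = 1)%g := GG.
apply: (@isomorphic_intro _ _ _ (fun u : (C_2 * C_2)%type => F ^+ (u.1 : 'Z_2) * G ^+ (u.2 : 'Z_2))%g).
- by rewrite mulg1.
- move=> [a b] [a' b'] /=; rewrite (eD a a') (Zp_expgD b b' G2).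
  by apply: mulgACA_commute; apply/commuteX2.
- have nG (a a' : 'Z_2) : (F ^+ a <> F ^+ a' * G)%g.
    move=> E; apply: (eG (- a' + a)); apply: (mulgI (F ^+ a')%g).
    by rewrite -E -(eD a' (- a' + a)) addNKr.
  move=> [a b] [a' b']; case: b => -[|[|//]] ltb; case: b' => -[|[|//]] ltb' /=;
    rewrite ?expg0 ?expg1 ?mulg1 => E.
  + by rewrite (e_inj _ _ E); congr pair; apply/val_inj.
  + by case: (nG _ _ E).
  + by case: (nG _ _ (esym E)).
  + by move/mulIg/e_inj: E => ->; congr pair; apply/val_inj.
- move=> x; rewrite RE; split=> [[a [->|->]]|[[a b] <-]].
  + by exists (a, 0); rewrite mulg1.
  + by exists (a, 1).
  + by exists a; case: b => -[|[|//]] ltb /=; rewrite ?mulg1; [left|right].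
Qed.

Lemma tr1_isomorphic F : \det (mx F) = 1 -> \tr (mx F) ^+ 2 = 1 ->
  isomorphic_to (rev_sym_group F) D_3 /\ reversible F.
Proof.
move=> detF trF; have [FFF F1] := tr1_order detF trF.
have [|G [GG FGF _]] := @finite_order_reversor F.
  by rewrite /disc detF trF.
split; last by apply/reversibleP; exists G.
have FF1 : (F * F <> 1)%g by move=> FF; apply: F1; rewrite -FFF FF mulg1.
have F3 : (F ^+ 3 = 1)%g := FFF.
have eD (a b : 'Z_3) := Zp_expgD a b F3.
have e_inj : injective (fun a : 'Z_3 => F ^+ a)%g.
  have e0 (a : 'Z_3) : (F ^+ a = 1)%g -> a = 0.
    by case: a => -[|[|[|//]]] lta E; [apply/val_inj | case: F1 | case: FF1].
  move=> a b /= E; apply: subr0_eq; apply: e0.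
  by apply: (mulgI (F ^+ b)%g); rewrite -(eD b (a - b)) addrC subrK mulg1.
have GF : (G * F = F^-1 * G)%g by rewrite -{2}FGF !mulgA mulVg mul1g.
have ge (a : 'Z_3) : (G * F ^+ a = F ^+ (- a)%R * G)%g.
  have -> : (F ^+ (- a)%R = F^-1 ^+ a)%g.
    apply: (mulIg (F ^+ a)%g); rewrite -(eD (- a) a) addNr expVgn mulVg //.
  elim: (nat_of_ord a) => [|k IH]; first by rewrite mulg1 mul1g.
  by rewrite expgSr mulgA IH -mulgA GF mulgA expgSr.
apply: (isomorphic_dihedral eD e_inj GG ge).
  move=> a aG; apply: FF1; apply: (mulIg G); rewrite mul1g -[RHS]FGF.
  by rewrite -!mulgA; congr (_ * _)%g; rewrite -aG; apply/commuteX/commute_refl.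
move=> x; rewrite rev_sym_groupP; split.
- case=> [/(tr1_centralizer detF trF)[]->|].
  + by exists 0; left.
  + by exists 1; left.
  + by exists 2; left.
  + move/(reversing_centralizer _ GG FGF)/(tr1_centralizer detF trF) => xG.
    have -> : x = (x * G * G)%g by rewrite -mulgA GG mulg1.
    by case: xG => ->; [exists 0|exists 1|exists 2]; right.
- have comm (a : 'Z_3) : (F * F ^+ a = F ^+ a * F)%g by apply/commuteX/commute_refl.
  case=> a [->|->]; [left; exact: comm|right].
  by apply/(reversing_centralizer _ GG FGF); rewrite -(mulgA (F ^+ a)%g) GG mulg1.
Qed.

Lemma zexpgJ (gT : groupType) (x y : gT) n :
  zexpg (y * x / y)%g n = (y * zexpg x n / y)%g.
Proof.
have nat_case k : ((y * x / y) ^+ k = y * x ^+ k / y)%g.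
  elim: k => [|k IH]; first by rewrite mulg1 mulgV.
  by rewrite !expgS IH !mulgA mulgVK.
by case: n => k; rewrite /= nat_case // !invgM invgK !mulgA.
Qed.

(** Conjugation by G preserves the centralizer of F, so it sends u to some u^k; as it inverts F =
    u^j with j nonzero, k = -1. Now G^2 commutes with F, so it is a power of u, fixed and at the
    same time inverted by G: it is 1. *)
Lemma reversing_dihedral (gT : groupType) (F u G : gT) :
  (forall x, (F * x = x * F)%g <-> exists n, x = zexpg u n) ->
  (forall n, zexpg u n = 1%g -> n = 0) -> (F * F <> 1)%g -> (F * G * F = G)%g ->
  (G * G = 1)%g /\
  isomorphic_to (fun x : gT => F * x = x * F \/ F * x * F = x)%g D_oo.
Proof.
move=> centE u0 FF1 FGF.
have e_inj : injective (zexpg u).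
  move=> a b E; apply: subr0_eq; apply: u0.
  by rewrite zexpgD zexpgN E mulgV.
have GF : (G * F = F^-1 * G)%g by rewrite -{2}FGF !mulgA mulVg mul1g.
have FG : (F * G = G * F^-1)%g by rewrite -{2}FGF mulgK.
have [j Fj] : exists j, F = zexpg u j by apply/centE.
have j0 : j != 0.
  by apply/eqP => j0; apply: FF1; rewrite Fj j0 mulg1.
have [k Gu] : exists k, (G * u / G = zexpg u k)%g.
  apply/centE; have FVu : (F^-1 * u = u * F^-1)%g.
    by apply/esym/commuteV/esym; apply/centE; exists 1.
  have GVF : (F^-1 / G = G^-1 * F)%g.
    by apply: (mulgI G); rewrite mulgA -FG mulgK mulVKg.
  rewrite !mulgA FG -(mulgA G) FVu -!mulgA; congr (G * (u * _))%g; exact: GVF.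
have GuX n : (G * zexpg u n / G = zexpg u (k * n))%g by rewrite -zexpgJ Gu zexpgM.
have k1 : k = -1.
  have : zexpg u (k * j) = zexpg u (- j).
    by rewrite -GuX -Fj GF mulgK zexpgN -Fj.
  by move/e_inj => E; apply: (mulIf j0); rewrite E mulN1r.
rewrite {}k1 in GuX.
have GG : (G * G = 1)%g.
  have [l GGl] : exists l, (G * G = zexpg u l)%g.
    by apply/centE; rewrite mulgA FG -!mulgA GF.
  have := GuX l; rewrite -GGl mulgA mulgK GGl => /e_inj E.
  by have -> : l = 0 by lia.
split=> //; apply: (@isomorphic_dihedral _ _ _ (zexpg u) G) => //.
- exact: zexpgD.
- by move=> a; rewrite -mulN1r -GuX mulgVK.
- move=> a Ga; apply: FF1; apply: (mulIg G); rewrite mul1g -[RHS]FGF -!mulgA; congr (_ * _)%g.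
  by apply/centE; exists a.
- move=> x; rewrite (reversing_centralizer _ GG FGF) !centE; split=> [[[n ->]|[n E]]|[n [->|->]]].
  + by exists n; left.
  + by exists n; right; rewrite -E -mulgA GG mulg1.
  + by left; exists n.
  + by right; exists n; rewrite -mulgA GG mulg1.
Qed.

Lemma infinite_isomorphic F : F <> 1%g -> \tr (mx F) != 0 -> 0 <= disc (mx F) ->
  [/\ (forall n, (0 < n)%N -> F ^+ n <> 1)%g,
      ~ reversible F -> isomorphic_to (rev_sym_group F) C_oo
    & reversible F -> isomorphic_to (rev_sym_group F) D_oo
        /\ exists G, [/\ rev_sym_group F G, (G * G = 1)%g & G <> 1%g]].
Proof.
move=> F1 trF discF; have F_oo := infinite_order F1 trF discF.
have [u Fu centF] := cyclic_centralizer F1 trF discF.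
have [j Fj] : exists j, F = zexpg u j by apply: centF.
(* F is a power of u, so u has infinite order along with F. *)
have u0 n : zexpg u n = 1%g -> n = 0.
  move=> un; have : zexpg F n = 1%g.
    by rewrite Fj zexpgM mulrC -zexpgM un; case: (j) => k; rewrite /= expg1n ?invg1.
  case: n {un} => [[|n]|n] //= Fn; first by case: (F_oo n.+1).
  by case: (F_oo n.+1) => //; apply/eqP; rewrite -invg_eq1 Fn.
have e_inj : injective (zexpg u).
  move=> a b E; apply: subr0_eq; apply: u0.
  by rewrite zexpgD zexpgN E mulgV.
have centE x : (F * x = x * F)%g <-> exists n, x = zexpg u n.
  by split=> [/centF//|[n ->]]; rewrite Fj -!zexpgD addrC.
split=> // [F_nr|].
  apply: (@isomorphic_intro _ _ _ (zexpg u : C_oo -> _)) => // [a b|x].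
    exact: zexpgD.
  rewrite rev_sym_groupP centE; split=> [[[n ->]|FxF]|[n <-]]; first by exists n.
    by case: F_nr; apply/reversibleP; exists x.
  by left; exists n.
move=> /reversibleP[G FGF].
have FF1 : (F * F <> 1)%g by apply: (F_oo 2).
have [GG [f [f_inj fE]]] := reversing_dihedral centE u0 FF1 FGF.
split; first by exists f; split=> // x; rewrite rev_sym_groupP.
exists G; split=> //; first by rewrite rev_sym_groupP; right.
by move=> G1; apply: FF1; rewrite -[RHS]G1 -[RHS]FGF G1 mulg1.
Qed.

(** * Telling the groups apart by the orders of their elements *)

Lemma isomorphic_expgP (gT : groupType) (R : trace_map -> Prop) n :
  isomorphic_to R gT -> (forall g : gT, g ^+ n = 1 -> g = 1)%g ->
  forall x, R x -> (x ^+ n = 1)%g -> x = 1%g.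
Proof.
move=> [f [f_inj fE]] tf x /fE[g <-]; have f1 : f 1%g = 1%g by exact: gmulf1.
by rewrite -gmulfXn -[X in _ = X -> _]f1 => /f_inj/tf->.
Qed.

Lemma D_2_sq (g : D_2) : (g ^+ 2 = 1)%g.
Proof. by case: g => -[[|[|//]] lta] [] //; congr pair; apply/val_inj. Qed.

Lemma C_2_sq (g : (C_2 * C_2)%type) : (g ^+ 2 = 1)%g.
Proof.
by case: g => -[[|[|//]] lta] [[|[|//]] ltb] //; congr pair; apply/val_inj.
Qed.

Lemma D_3_order (g : D_3) : (g ^+ 2 = 1 \/ g ^+ 3 = 1)%g.
Proof.
by case: g => -[[|[|[|//]]] lta] []; [left|right|left|right|left|right] => //;
  congr pair; apply/val_inj.
Qed.

Lemma C_oo_sq (g : C_oo) : (g ^+ 2 = 1 -> g = 1)%g.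
Proof.
by move=> E; have E' : (g : int) + g = 0 := E; apply: (_ : g = 0 :> int); lia.
Qed.

Lemma C_oo_cube (g : C_oo) : (g ^+ 3 = 1 -> g = 1)%g.
Proof.
by move=> E; have E' : (g : int) + (g + g) = 0 := E; apply: (_ : g = 0 :> int); lia.
Qed.

Lemma D_oo_cube (g : D_oo) : (g ^+ 3 = 1 -> g = 1)%g.
Proof.
case: g => a [] // E; have := congr1 fst E; rewrite /= => aa; congr pair; lia.
Qed.

Lemma swap_neq1 : swap <> 1%g.
Proof.
move=> S1; have := mx_uniq _ represents_swap; rewrite S1 det_mx2 => /(_ erefl) /eqpm_sym.
move/eqpm_trans/(_ mx1); rewrite /eqpm mx2_1 mx2N.
by case=> /mx2_inj[].
Qed.

Lemma rotation_order : (rotation ^+ 3 = 1)%g /\ rotation <> 1%g.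
Proof.
split; first exact: rotation_cube.
move=> C1; have := mx_uniq _ represents_rotation; rewrite C1 det_mx2 => /(_ erefl) /eqpm_sym.
move/eqpm_trans/(_ mx1); rewrite /eqpm mx2_1 mx2N.
by case=> /mx2_inj[].
Qed.

(** Shows that the group of all trace maps is not D_3. *)
Lemma exists_parabolic : exists P : trace_map, (P ^+ 2 <> 1 /\ P ^+ 3 <> 1)%g.
Proof.
have [|P PA] := @mx_surj (mx2 1 1 0 1); first by rewrite det_mx2.
exists P; split=> P1.
  have := eqpm_trans (eqpm_sym (eqpm_trans (mxX P 2) (eqpmX 2 PA))).
  rewrite P1 => /(_ _ mx1); rewrite expr2 mx2M /eqpm mx2_1 mx2N.
  by case=> /mx2_inj[].
have := eqpm_trans (eqpm_sym (eqpm_trans (mxX P 3) (eqpmX 3 PA))).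
rewrite P1 => /(_ _ mx1); rewrite exprS expr2 !mx2M /eqpm mx2_1 mx2N.
by case=> /mx2_inj[].
Qed.

Lemma rev_sym_group1 G : rev_sym_group 1%g G.
Proof. by left; rewrite /is_symmetry mul1g mulg1. Qed.

Lemma rev_sym_group_refl F : rev_sym_group F F.
Proof. by left. Qed.

Lemma reversible_involution F : (F * F = 1)%g -> reversible F.
Proof. by move=> FF; apply/reversibleP; exists 1%g; rewrite mulg1. Qed.

Variant trace_map_type (F : trace_map) : Prop :=
| TypeIdentity of F = 1%g
| TypeOrder2 of (F ^+ 2 = 1)%g & F <> 1%g & isomorphic_to (rev_sym_group F) D_2
    & isomorphic_to (rev_sym_group F) (C_2 * C_2)%type
| TypeOrder3 of (F ^+ 3 = 1)%g & F <> 1%g & reversible F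
    & isomorphic_to (rev_sym_group F) D_3
| TypeInfiniteReversible of (forall n, (0 < n)%N -> F ^+ n <> 1)%g & reversible F
    & isomorphic_to (rev_sym_group F) D_oo
    & exists G, [/\ rev_sym_group F G, (G ^+ 2 = 1)%g & G <> 1%g]
| TypeInfiniteIrreversible of (forall n, (0 < n)%N -> F ^+ n <> 1)%g
    & ~ reversible F & isomorphic_to (rev_sym_group F) C_oo.

Lemma trace_map_typeP F : trace_map_type F.
Proof.
have [->|/eqP F1] := eqVneq F 1%g; first exact: TypeIdentity.
have [trF|trF] := eqVneq (\tr (mx F)) 0.
  have [RD RC] := tr0_isomorphic trF; have [FF _] := tr0_order trF.
  exact: TypeOrder2.
(* A negative discriminant with nonzero trace means determinant 1 and trace 1 or -1. *)
have [|discF] := ltP (disc (mx F)) 0.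
  have [dF|dF] := sq_eq1 (det_mx_sq F); rewrite /disc dF => disc_lt0; last by nia.
  have trF1 : \tr (mx F) ^+ 2 = 1.
    by have [->|->] : \tr (mx F) = 1 \/ \tr (mx F) = -1 by nia.
  have [FFF _] := tr1_order dF trF1; have [RD rF] := tr1_isomorphic dF trF1.
  exact: TypeOrder3.
have [F_oo irrev rev] := infinite_isomorphic F1 trF discF.
have [rF|nrF] := classic (reversible F); last exact: TypeInfiniteIrreversible (irrev nrF).
by have [RD G] := rev rF; apply: TypeInfiniteReversible.
Qed.

Theorem theorem2 (F : trace_map) :
  let R := rev_sym_group F in
  [/\ isomorphic_to R C_oo <-> ~ reversible F,
      (forall G : trace_map, R G) <-> (F = 1)%g,
      (isomorphic_to R D_2 <-> (F ^+ 2 = 1 /\ F <> 1)%g) /\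
      (isomorphic_to R (C_2 * C_2)%type <-> (F ^+ 2 = 1 /\ F <> 1)%g),
      isomorphic_to R D_3 <-> (F ^+ 3 = 1 /\ F <> 1)%g
    & truly_reversible F -> ~ finite_order F -> isomorphic_to R D_oo] /\
  (isomorphic_to R C_oo \/ (forall G : trace_map, R G) \/
   isomorphic_to R D_2 \/ isomorphic_to R D_3 \/ isomorphic_to R D_oo).
Proof.
move=> R; have RF : R F := rev_sym_group_refl F.
have [rot3 rot1] := rotation_order; have [P [P2 P3]] := exists_parabolic.
have swap2 : (swap ^+ 2 = 1)%g := swap_sq.
have rot2 : (rotation ^+ 2 <> 1)%g.
  by move=> rot2; apply: rot1; have := rot3; rewrite expgSr rot2 mul1g.
have exponent2 (gT : groupType) : isomorphic_to R gT -> (forall g : gT, g ^+ 2 = 1)%g ->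
    forall x, R x -> (x ^+ 2 = 1)%g.
  by move=> [f [_ fE]] sq x /fE[g <-]; rewrite -gmulfXn sq gmulf1.
have D3_order : isomorphic_to R D_3 -> forall x, R x -> (x ^+ 2 = 1 \/ x ^+ 3 = 1)%g.
  by move=> [f [_ fE]] x /fE[g <-]; rewrite -!gmulfXn; case: (D_3_order g) => ->;
     rewrite gmulf1; [left|right].
have F23 : (F ^+ 2 = 1 -> F ^+ 3 = 1 -> F = 1)%g.
  by move=> F2; rewrite expgSr F2 mul1g.
have C_oo_sqP (RC : isomorphic_to R C_oo) := isomorphic_expgP (n := 2) RC C_oo_sq.
have C_oo_cubeP (RC : isomorphic_to R C_oo) := isomorphic_expgP (n := 3) RC C_oo_cube.
have D_oo_cubeP (RD : isomorphic_to R D_oo) := isomorphic_expgP (n := 3) RD D_oo_cube.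
(* The type of F settles which group occurs; the other groups are excluded by element orders. C_oo
   has no elements of order 2 or 3 and D_oo none of order 3, D_2 has exponent 2, and in D_3 every
   element is killed by 2 or 3. The full group is tested on [swap], [rotation] and [P]. *)
case: (trace_map_typeP F) => [F1|F2 F1 RD RC|F3 F1 rF RD|F_oo rF RD [G [RG G2 G1]]|F_oo nrF RC].
- have Rall G : R G by rewrite /R F1; apply: rev_sym_group1.
  have Fsq : (F * F = 1)%g by rewrite F1 mulg1.
  split; last by right; left.
  split=> //.
  + split=> [RC|[]]; last exact: reversible_involution.
    by case: swap_neq1; apply: (C_oo_sqP RC).
  + split; (split=> [iso|[_ /(_ F1)]//]).
      by case: rot2; apply: exponent2 iso D_2_sq _ (Rall _).
    by case: rot2; apply: exponent2 iso C_2_sq _ (Rall _).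
  + split=> [iso|[_ /(_ F1)]//].
    by case: (D3_order iso P (Rall P)).
  + by move=> [_ F2]; case: F2; rewrite F1 expg1n.
- have noinf (Q : Prop) : (forall x, R x -> x ^+ 2 = 1)%g -> (forall G, R G) -> Q.
    by move=> sq Rall; case: rot2; apply: sq.
  have sqR := exponent2 _ RD D_2_sq.
  split; last by right; right; left.
  split.
  + split=> [iso|[]]; last exact: reversible_involution.
    by case: F1; apply: (C_oo_sqP iso).
  + by split=> [|/F1//]; apply: noinf.
  + by [].
  + split=> [[f [f_inj fE]]|[/(F23 F2)/F1//]].
    suff : (f (1%R, false) ^+ 2 = 1)%g.
      by rewrite -gmulfXn -[X in _ = X](gmulf1 (s := f)) => /f_inj/(congr1 fst).
    by apply: sqR; apply/fE; eexists.
  + by move=> [_ /(_ F2)].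
- split; last by right; right; right; left.
  split.
  + split=> [iso|/(_ rF)//]; case: F1; apply: (C_oo_cubeP iso) => //.
  + split=> [Rall|/F1//]; by case: (D3_order RD P (Rall P)).
  + split; (split=> [iso|[/F23/(_ F3)/F1//]]); case: F1; apply: F23 F3.
      exact: exponent2 iso D_2_sq F RF.
    exact: exponent2 iso C_2_sq F RF.
  + by [].
  + by move=> _ []; exists 3.
- have [F_oo1 F_oo2 F_oo3] : [/\ F <> 1, F ^+ 2 <> 1 & F ^+ 3 <> 1]%g.
    by split; [exact: (F_oo 1%N) | exact: (F_oo 2) | exact: (F_oo 3)].
  split; last by right; right; right; right.
  split.
  + split=> [iso|/(_ rF)//]; by case: G1; apply: (C_oo_sqP iso).
  + split=> [Rall|F1]; last by case: F_oo1.
    by case: rot1; apply: (D_oo_cubeP RD).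
  + split; (split=> [iso|[/F_oo2//]]); case: F_oo2.
      exact: exponent2 iso D_2_sq F RF.
    exact: exponent2 iso C_2_sq F RF.
  + split=> [iso|[/F_oo3//]].
    by case: (D3_order iso F RF); [move/F_oo2 | move/F_oo3].
  + by [].
- have [F_oo1 F_oo2 F_oo3] : [/\ F <> 1, F ^+ 2 <> 1 & F ^+ 3 <> 1]%g.
    by split; [exact: (F_oo 1%N) | exact: (F_oo 2) | exact: (F_oo 3)].
  split; last by left.
  split.
  + by [].
  + split=> [Rall|F1]; last by case: F_oo1.
    by case: rot1; apply: (C_oo_cubeP RC).
  + split; (split=> [iso|[/F_oo2//]]); case: F_oo2.
      exact: exponent2 iso D_2_sq F RF.
    exact: exponent2 iso C_2_sq F RF.
  + split=> [iso|[/F_oo3//]].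
    by case: (D3_order iso F RF); [move/F_oo2 | move/F_oo3].
  + by move=> [].
Qed.
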